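(* There exist absolute constants $C,k>0$ such that the following holds for every prime power $q$; write $\Lambda=C(\log q)^k$. Let $A,X\subseteq\mathbb{F}_q^*$ be nonempty. If there is a positive real number $K>0$ such that \[ \sum_{\xi\in X}E(A,\xi A)\ \ge\ \frac{|A|^3|X|}{K}, \] then there exist elements $\bar a\in A$ and $x_0\in X$ and subsets $A_1\subseteq A-\bar a$ and $X'\subseteq x_0^{-1}X$ such that: \begin{enumerate} \item[(i)] $|A_1|\ge\Lambda^{-1}K^{-85}|A|$ and $|X'|\ge\Lambda^{-1}K^{-5}|X|$; \item[(ii)] $|A_1+X'A_1|\le\Lambda K^{226}|A_1|$; \item[(iii)] $|A_1+A_1|\le\Lambda K^{92}|A_1|$ and $|A_1-A_1|\le\Lambda K^{92}|A_1|$; \item[(iv)] $|A_1+x'A_1|\le\Lambda K^{126}|A_1|$ and $|A_1-x'A_1|\le\Lambda K^{126}|A_1|$ for all $x'\in X'$. \end{enumerate} Moreover, if $E(A,\xi A)\ge|A|^3/K$ for all $\xi\in X$, then the same holds with $|X'|\ge\Lambda^{-1}K^{-4}|X|$.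
   Context: $\mathbb{F}_q$ is the finite field with $q$ elements, $\mathbb{F}_q^*=\mathbb{F}_q\setminus\{0\}$. For $A\subseteq\mathbb{F}_q$ and $\xi\in\mathbb{F}_q^*$, $E(A,\xi A)=|\{(a_1,a_2,a_3,a_4)\in A^4: a_1-a_2=\xi(a_3-a_4)\}|$. Sums, differences, products and dilates of sets are elementwise, e.g. $X'A_1=\{xa:x\in X',a\in A_1\}$, $x_0^{-1}X=\{x_0^{-1}x:x\in X\}$, $A-\bar a=\{a-\bar a:a\in A\}$. *)

(* Defs.v *)
From HB Require Import structures.
From mathcomp Require Import all_boot all_order all_algebra.
From mathcomp Require Import all_classical all_reals all_analysis.
Set Implicit Arguments.
Unset Strict Implicit.
Unset Printing Implicit Defensive.
Import Order.TTheory GRing.Theory Num.Theory.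
Local Open Scope ring_scope.

Definition sumset (F : finFieldType) (A B : {set F}) : {set F} :=
  [set (a + b : F) | a : F in A, b : F in B].

Definition diffset (F : finFieldType) (A B : {set F}) : {set F} :=
  [set (a - b : F) | a : F in A, b : F in B].

Definition prodset (F : finFieldType) (X A : {set F}) : {set F} :=
  [set (x * a : F) | x : F in X, a : F in A].

Definition dilate (F : finFieldType) (x : F) (A : {set F}) : {set F} :=
  [set x * a | a in A].

Definition shift (F : finFieldType) (A : {set F}) (c : F) : {set F} :=
  [set (a - c : F) | a : F in A].

(* E(A, xi A); the nested pair (((a1, a2), a3), a4) encodes a quadruple. *)
Definition energy (F : finFieldType) (A : {set F}) (xi : F) : nat :=
  #|[set t : F * F * F * F |
      let: (a1, a2, a3, a4) := t in
      [&& a1 \in A, a2 \in A, a3 \in A, a4 \in A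
        & a1 - a2 == xi * (a3 - a4)]]|.

(* The exponent m of K in the lower bound for |X'| is a parameter because it
   depends on whether the energy is bounded below on average or pointwise. *)
Definition structured_subsets (R : realType) (F : finFieldType)
    (L K : R) (m : nat) (A X : {set F}) : Prop :=
  exists (abar x0 : F) (A1 X' : {set F}),
    [/\ abar \in A, x0 \in X,
        A1 \subset shift A abar & X' \subset dilate x0^-1 X]
    /\ [/\ L^-1 * K ^- 85 * #|A|%:R <= (#|A1|%:R : R)
             /\ L^-1 * K ^- m * #|X|%:R <= (#|X'|%:R : R),
           (#|sumset A1 (prodset X' A1)|%:R : R) <= L * K ^+ 226 * #|A1|%:R,
           (#|sumset A1 A1|%:R : R) <= L * K ^+ 92 * #|A1|%:R
             /\ (#|diffset A1 A1|%:R : R) <= L * K ^+ 92 * #|A1|%:R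
         & forall x', x' \in X' ->
             (#|sumset A1 (dilate x' A1)|%:R : R) <= L * K ^+ 126 * #|A1|%:R
             /\ (#|diffset A1 (dilate x' A1)|%:R : R)
                  <= L * K ^+ 126 * #|A1|%:R].

(* Main.v *)
(* By Balog-Szemeredi-Gowers and Cauchy-Schwarz over [X], some [x0] in [X] and
   [B] contained in [A] have the property that, with [K^O(1)] losses, [B] has
   small doubling and is commensurable with [x * B] for every [x] in a large
   subset [X'] of [x0^-1 X].  What remains is to find a large [A1] in a
   translate of [B] for which the union of all the [A1 + x * A1] is small.  If
   [X'] has size [K^O(1)] a translate of [B] will do.  Otherwise, let [k] be the
   field generated by [X'].  For [U] contained in [k], commensurable with all
   its dilates by [X'], the size of [U + y * U] varies by a bounded factor when
   [y] is replaced by [x * y] or [y + x], so that it takes intermediate values as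
   [y] runs through [k]; an energy count with such a [y] bounds [#|X'|], unless
   [U] has bounded size or bounded index in [k].  So the intersections of [B]
   with translates of a line [k * v] are either small or of bounded index in the
   line; a positive proportion of the differences of [B] must have a direction
   [v] of the second kind, and [A1] consists of such differences. *)

Require Import Defs.
From HB Require Import structures.
From mathcomp Require Import all_boot all_order all_algebra.
From mathcomp Require Import all_classical all_reals all_analysis.
From mathcomp Require Import fintype finset ring lra.
Set Implicit Arguments.
Unset Strict Implicit.
Unset Printing Implicit Defensive.
Import Order.TTheory GRing.Theory Num.Theory.
Local Open Scope ring_scope.

(** * Counting, sumsets and Ruzsa triangle inequalities *)

(** The obstacle is (ii). Bounding each [A1 + x * A1] separately and adding up costs a factor
    [#|X'|]. The way out is one small set for all [x]: if [a] and [a'] are directions in which [B]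
    fills a positive proportion of a line, then a positive proportion of the multiples of
    [a' + x * a] by [k] lies in [(B + B) - (B + B)], whatever [x] is, and counting multiples bounds
    the whole union. A second difficulty is that Balog-Szemeredi-Gowers yields a different pair of
    subsets for each [xi]. Cauchy-Schwarz is applied to their products inside [A * A], so that both
    members of a pair meet those of the pivot [x0] at once. Logarithms enter only through dyadic
    pigeonholing, of multiplicities and of graph densities. They are carried by [w = 256 * l * K].
    The common density [s] of the pairs is kept as a parameter and only at the end estimated by
    [2 <= w * s], which saves powers of [K]. The growth parameters become [b = w^26] and
    [kappa = w^12], and the largest loss is [kappa^4 * b^6 = w^204]. *)

Lemma card_fibers (T T' : finType) (f : T -> T') (D : {set T}) (I : {set T'}) :
    {in D, forall d, f d \in I} ->
  #|D| = (\sum_(t in I) #|[set d in D | f d == t]|)%N.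
Proof.
move=> fDI; rewrite -sum1_card (partition_big f (mem I)) //=.
by apply: eq_bigr => t _; rewrite -sum1_card; apply: eq_bigl => d; rewrite inE.
Qed.

Lemma large_fiber (T T' : finType) (f : T -> T') (D : {set T}) (I : {set T'}) :
    D != set0 -> {in D, forall d, f d \in I} ->
  exists2 t, t \in I & (#|D| <= #|I| * #|[set d in D | f d == t]|)%N.
Proof.
case/set0Pn=> d0 d0D fDI; rewrite (card_fibers fDI).
case: (@arg_maxnP _ (f d0) (mem I) (fun t => #|[set d in D | f d == t]|)).
  exact: fDI.
by move=> t tI tmax; exists t => //; rewrite -sum_nat_const leq_sum.
Qed.

Lemma card_le_fibers (T T' : finType) (f : T -> T') (D : {set T})
    (I : {set T'}) m :
    {in D, forall d, f d \in I} ->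
    (forall t, #|[set d in D | f d == t]| <= m)%N ->
  (#|D| <= #|I| * m)%N.
Proof.
by move=> fDI mP; rewrite (card_fibers fDI) -sum_nat_const leq_sum.
Qed.

Lemma card_collisions (T T' : finType) (f : T -> T') (D : {set T}) :
  #|[set p : T * T | [&& p.1 \in D, p.2 \in D & f p.1 == f p.2]]|
    = (\sum_t #|[set d in D | f d == t]| ^ 2)%N.
Proof.
rewrite (@card_fibers _ _ (fun p => f p.1) _ [set: T']); last by move=> p _; rewrite in_setT.
apply: eq_big => [t|t _]; first by rewrite ?in_setT.
rewrite expnS expn1 -cardsX; apply: eq_card => -[d e] /=; rewrite !inE /=.
by case: (f d =P t) => [->|_]; rewrite ?andbT ?andbF // [t == _]eq_sym andbA.
Qed.

Lemma sum_sqr_ge (R : realFieldType) (T : finType) (I : {set T}) (f : T -> R) :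
  (\sum_(i in I) f i) ^+ 2 <= #|I|%:R * \sum_(i in I) f i ^+ 2.
Proof.
set S := \sum_(i in I) f i; set Q := \sum_(i in I) f i ^+ 2.
have [I0|I0] := eqVneq I set0.
  by rewrite /S /Q I0 !big_set0 cards0 mul0r expr0n.
have n_gt0 : 0 < #|I|%:R :> R by rewrite ltr0n card_gt0.
have : 0 <= \sum_(i in I) (#|I|%:R * f i - S) ^+ 2.
  by apply: sumr_ge0 => i _; apply: sqr_ge0.
under eq_bigr do rewrite sqrrB exprMn.
rewrite big_split sumrB /= -mulr_sumr sumr_const.
have -> : \sum_(i in I) (#|I|%:R * f i * S) *+ 2 = #|I|%:R * S ^+ 2 *+ 2.
  rewrite sumrMnl -mulr_suml -mulr_sumr -/S; ring.
rewrite -/Q -[_ *+ #|I|]mulr_natl => H; rewrite -subr_ge0 -(pmulr_rge0 _ n_gt0).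
apply: le_trans H _; rewrite le_eqVlt; apply/orP; left; apply/eqP; ring.
Qed.

Section Sumsets.
Variable F : finFieldType.
Implicit Types (A B C D P Q S U X Z : {set F}) (c x y z : F).

Lemma mem_sumset A B x y : x \in A -> y \in B -> x + y \in sumset A B.
Proof. by move=> xA yB; apply: imset2_f. Qed.

Lemma mem_diffset A B x y : x \in A -> y \in B -> x - y \in diffset A B.
Proof. by move=> xA yB; apply/imset2P; exists x y. Qed.

Lemma mem_dilate c A x : x \in A -> c * x \in dilate c A.
Proof. by move=> xA; apply: imset_f. Qed.

Lemma diffsetE A B : diffset A B = sumset A (dilate (-1) B).
Proof.
apply/setP=> z; apply/imset2P/imset2P => -[x y xA].
  by move=> yB ->; exists x (-1 * y); rewrite ?mem_dilate ?mulN1r.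
by case/imsetP=> y' yB -> ->; exists x y'; rewrite ?mulN1r.
Qed.

Lemma sumsetC A B : sumset A B = sumset B A.
Proof.
by apply/setP=> z; apply/imset2P/imset2P => -[x y xA yB ->];
  exists y x; rewrite // addrC.
Qed.

Lemma sumsetA A B C : sumset A (sumset B C) = sumset (sumset A B) C.
Proof.
apply/setP=> z; apply/imset2P/imset2P.
  by case=> x _ xA /imset2P[y t yB tC ->] ->; exists (x + y) t; rewrite ?mem_sumset ?addrA.
by case=> _ t /imset2P[x y xA yB ->] tC ->; exists x (y + t); rewrite ?mem_sumset ?addrA.
Qed.

Lemma sumsetAC A B C : sumset (sumset A B) C = sumset (sumset A C) B.
Proof. by rewrite -!sumsetA [sumset B C]sumsetC. Qed.

Lemma sumsetS A B C D :
  A \subset C -> B \subset D -> sumset A B \subset sumset C D.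
Proof. by move=> AC BD; apply: imset2S. Qed.

Lemma diffsetS A B C D :
  A \subset C -> B \subset D -> diffset A B \subset diffset C D.
Proof.
move=> /subsetP AC /subsetP BD; apply/subsetP=> z /imset2P[x y xA yB ->].
by rewrite mem_diffset ?AC ?BD.
Qed.

Lemma dilate_dilate c x A : dilate c (dilate x A) = dilate (c * x) A.
Proof. by rewrite /dilate -imset_comp; apply: eq_imset => y /=; rewrite mulrA. Qed.

Lemma dilate1 A : dilate 1 A = A.
Proof.
by rewrite /dilate -[RHS]imset_id; apply: eq_imset => y; rewrite mul1r.
Qed.

Lemma dilate_sumset c A B :
  dilate c (sumset A B) = sumset (dilate c A) (dilate c B).
Proof.
apply/setP=> z; apply/imsetP/imset2P.
  by case=> _ /imset2P[x y xA yB ->] ->; exists (c * x) (c * y); rewrite ?mem_dilate ?mulrDr.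
case=> _ _ /imsetP[x xA ->] /imsetP[y yB ->] ->.
by exists (x + y); rewrite ?mem_sumset ?mulrDr.
Qed.

Lemma card_dilate c A : c != 0 -> #|dilate c A| = #|A|.
Proof. by move=> c0; apply: card_imset; apply: mulfI. Qed.

Lemma card_diffsetC A B : #|diffset A B| = #|diffset B A|.
Proof.
rewrite -(@card_dilate (-1)) ?oppr_eq0 ?oner_eq0 // !diffsetE dilate_sumset.
by rewrite dilate_dilate mulrNN mulr1 dilate1 sumsetC.
Qed.

Lemma card_sumset_ge A B : B != set0 -> (#|A| <= #|sumset A B|)%N.
Proof.
case/set0Pn=> b bB; rewrite -(card_imset (mem A) (addIr b)).
by apply/subset_leq_card/subsetP=> _ /imsetP[a aA ->]; rewrite mem_sumset.
Qed.

Lemma card_diffset_ge A B : B != set0 -> (#|A| <= #|diffset A B|)%N.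
Proof.
case/set0Pn=> b bB; rewrite diffsetE card_sumset_ge //.
by apply/set0Pn; exists (-1 * b); rewrite mem_dilate.
Qed.

(** Fix one representation [d = p - q] of each difference. Then [(d, s)] is recovered from
    [(p + s, q + s)]: the difference of the coordinates is [d], which determines [p] and then
    [s]. *)
Lemma ruzsa_triangle P Q S :
  (#|diffset P Q| * #|S| <= #|sumset P S| * #|sumset Q S|)%N.
Proof.
pose rep d := odflt (0, 0) [pick p : F * F | [&& p.1 \in P, p.2 \in Q & p.1 - p.2 == d]].
have repP d : d \in diffset P Q ->
    [/\ (rep d).1 \in P, (rep d).2 \in Q & (rep d).1 - (rep d).2 = d].
  case/imset2P=> p q pP qQ ->; rewrite /rep; case: pickP => [r|/(_ (p, q))].
    by case/and3P=> ? ? /eqP.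
  by rewrite /= pP qQ eqxx.
rewrite -!cardsX -(@card_in_imset _ _ (fun d => ((rep d.1).1 + d.2, (rep d.1).2 + d.2))).
  apply/subset_leq_card/subsetP=> _ /imsetP[[d s] /setXP[dD sS] ->].
  by have [rP rQ _] := repP d dD; rewrite inE /= !mem_sumset.
move=> [d s] [d' s'] /setXP[dD sS] /setXP[dD' sS'] /= [e1 e2].
have [_ _ ed] := repP d dD; have [_ _ ed'] := repP d' dD'.
have dd : d = d'.
  rewrite -ed -ed'; have -> : (rep d).1 - (rep d).2 = ((rep d).1 + s) - ((rep d).2 + s) by ring.
  by rewrite e1 e2; ring.
by move: e1; rewrite dd => /addrI ->.
Qed.

Lemma ruzsa_sum A B C :
  (#|sumset A C| * #|B| <= #|diffset A B| * #|sumset B C|)%N.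
Proof.
have N1 : -1 != 0 :> F by rewrite oppr_eq0 oner_eq0.
have := ruzsa_triangle A (dilate (-1) C) (dilate (-1) B).
rewrite !diffsetE dilate_dilate mulrNN mulr1 dilate1 -dilate_sumset.
by rewrite !card_dilate // [sumset C B]sumsetC.
Qed.

End Sumsets.

(** * Petridis' inequality and additive energy *)

Section Plunnecke.
Variable F : finFieldType.
Implicit Types (A B C S : {set F}).

Lemma min_doubling A B : A != set0 ->
  exists S, [/\ S \subset A, S != set0 &
    forall S', S' \subset A -> (#|sumset S B| * #|S'| <= #|sumset S' B| * #|S|)%N].
Proof.
move=> A0; pose P S := (S \subset A) && (S != set0).
have PA : P A by rewrite /P subxx.
pose M S : rat := #|sumset S B|%:R / #|S|%:R.
case: (@Order.TotalTheory.arg_minP _ _ _ A P M PA) => S /andP[SA S0] Smin.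
exists S; split=> // S' S'A; have [->|S'0] := eqVneq S' set0.
  by rewrite cards0 muln0.
have := Smin S'; rewrite /P S'A S'0 => /(_ isT).
rewrite /M ler_pdivrMr ?ltr0n ?card_gt0 // mulrAC ler_pdivlMr ?ltr0n ?card_gt0 //.
by rewrite -!natrM ler_nat.
Qed.

Lemma petridis A B : A != set0 ->
  exists S, [/\ S \subset A, S != set0,
    (#|sumset S B| * #|A| <= #|sumset A B| * #|S|)%N &
    forall C, (#|sumset (sumset S B) C| * #|S| <= #|sumset S B| * #|sumset S C|)%N].
Proof.
case/(min_doubling B)=> S [SA S0 Smin]; exists S; split=> //; first exact: Smin.
suff H n C : #|C| = n ->
    (#|sumset (sumset S B) C| * #|S| <= #|sumset S B| * #|sumset S C|)%N.
  by move=> C; apply: (H _ C erefl).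
elim: n C => [|n IHn] C.
  move/cards0_eq=> ->; have -> : sumset (sumset S B) set0 = set0 :> {set F}.
    by apply/setP=> z; rewrite in_set0; apply/negP=> /imset2P[x y _]; rewrite in_set0.
  by rewrite cards0.
move=> Cn; have /card_gt0P[c cC] : (0 < #|C|)%N by rewrite Cn.
set C' := C :\ c; have C'n : #|C'| = n.
  by move: Cn; rewrite (cardsD1 c) cC add1n => -[].
have CE : C = c |: C' by rewrite setD1K.
(* [V] consists of the [a] for which [a + B + c] brings nothing new. Adding [c] to [C'] thus creates
   at most [|S + B| - |V + B|] elements of [S + B + C] and at least [|S| - |V|] elements of [S + C];
   minimality of [S], applied to [V], compares the two. *)
pose V := [set a in S | [forall b in B, a + b + c \in sumset (sumset S B) C']].
have VS : V \subset S by apply/subsetP=> a; rewrite inE => /andP[].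
have VP a b : a \in V -> b \in B -> a + b + c \in sumset (sumset S B) C'.
  by rewrite inE => /andP[_ /forall_inP H] /H.
pose tr := fun x : F => x + c; have tr_inj : injective tr by apply: addIr.
have up : (#|sumset (sumset S B) C| + #|sumset V B| <=
           #|sumset (sumset S B) C'| + #|sumset S B|)%N.
  have sub : sumset (sumset S B) C \subset
      sumset (sumset S B) C' :|: (tr @: (sumset S B :\: sumset V B)).
    apply/subsetP=> _ /imset2P[x y xSB yC ->]; rewrite inE.
    move: yC; rewrite CE => /setU1P[->|yC']; last by rewrite mem_sumset.
    have [|xV] := boolP (x \in sumset V B).
      by case/imset2P=> a b aV bB ->; rewrite VP.
    apply/orP; right; apply: (imset_f tr); by rewrite inE xV.
  apply: leq_trans (leq_add (leq_trans (subset_leq_card sub) (leq_card_setU _ _)) (leqnn _)) _.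
  rewrite card_imset // -addnA leq_add2l.
  by rewrite cardsD (setIidPr (sumsetS VS (subxx _))) subnK // subset_leq_card // sumsetS.
have lo : (#|sumset S C'| + #|S| <= #|sumset S C| + #|V|)%N.
  have sub : sumset S C' :|: (tr @: (S :\: V)) \subset sumset S C.
    rewrite subUset sumsetS ?subD1set //=.
    apply/subsetP=> _ /imsetP[a /setDP[aS _] ->]; exact: mem_sumset.
  have dis : [disjoint sumset S C' & tr @: (S :\: V)].
    rewrite disjoint_sym disjoints_subset; apply/subsetP=> _ /imsetP[a /setDP[aS aV] ->].
    rewrite inE; apply: contra aV => /imset2P[a' c' a'S c'C' e].
    rewrite inE aS; apply/forall_inP => b bB.
    have -> : a + b + c = (a' + b) + c' by rewrite addrAC -/(tr a) e addrAC.
    by rewrite !mem_sumset.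
  have := subset_leq_card sub; rewrite cardsU (disjoint_setI0 dis) cards0 subn0.
  rewrite card_imset // cardsD (setIidPr VS) => H.
  apply: leq_trans (leq_add H (leqnn #|V|)).
  by rewrite -addnA subnK // subset_leq_card.
have IH := IHn C' C'n; have mV := Smin V (subset_trans VS SA).
have := leq_mul up (leqnn #|S|); have := leq_mul (leqnn #|sumset S B|) lo.
rewrite !mulnDl !mulnDr => H1 H2.
rewrite -(leq_add2r (#|sumset S B| * #|V|)).
apply: leq_trans H1; apply: leq_trans (leq_add (leqnn _) mV) _.
by apply: leq_trans H2 _; rewrite leq_add2r.
Qed.

End Plunnecke.

Section Energy.
Variables (R : realFieldType) (F : finFieldType).
Implicit Types (A B C D P Q S U X Z : {set F}) (c x y z : F).

Lemma energy_collisions A x :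
  energy A x = #|[set p : (F * F) * (F * F) |
    [&& p.1 \in setX A A, p.2 \in setX A A & p.1.1 - x * p.1.2 == p.2.1 - x * p.2.2]]|.
Proof.
pose f (t : F * F * F * F) := let: (a1, a2, a3, a4) := t in ((a1, a3), (a2, a4)).
have f_inj : injective f by move=> [[[? ?] ?] ?] [[[? ?] ?] ?] [-> -> -> ->].
rewrite /energy -(card_imset _ f_inj); apply: eq_card => -[[a1 a3] [a2 a4]].
rewrite [RHS]inE /= !in_setX /=; apply/imsetP/idP.
  case=> [[[[b1 b2] b3] b4]]; rewrite inE => /and5P[b1A b2A b3A b4A /eqP e] [-> -> -> ->].
  rewrite b1A b2A b3A b4A /=; apply/eqP; move/eqP: e; rewrite subr_eq => /eqP ->; ring.
case/and3P=> /andP[a1A a3A] /andP[a2A a4A] /eqP e.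
exists (a1, a2, a3, a4) => //; rewrite inE a1A a2A a3A a4A /=; apply/eqP.
move/eqP: e; rewrite subr_eq => /eqP ->; ring.
Qed.

(** Moving terms across the equation gives collisions of [a + x * c] instead of [a - x * c]. This
    form ties the energy to [A + x * A], the previous one to popular differences. *)
Lemma energy_collisions_sum A x :
  energy A x = #|[set p : (F * F) * (F * F) |
    [&& p.1 \in setX A A, p.2 \in setX A A & p.1.1 + x * p.1.2 == p.2.1 + x * p.2.2]]|.
Proof.
pose f (t : F * F * F * F) := let: (a1, a2, a3, a4) := t in ((a1, a4), (a2, a3)).
have f_inj : injective f by move=> [[[? ?] ?] ?] [[[? ?] ?] ?] [-> -> -> ->].
rewrite /energy -(card_imset _ f_inj); apply: eq_card => -[[a1 a4] [a2 a3]].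
rewrite [RHS]inE /= !in_setX /=; apply/imsetP/idP.
  case=> [[[[b1 b2] b3] b4]]; rewrite inE => /and5P[b1A b2A b3A b4A /eqP e] [-> -> -> ->].
  rewrite b1A b2A b3A b4A /=; apply/eqP; move/eqP: e; rewrite subr_eq => /eqP ->; ring.
case/and3P=> /andP[a1A a4A] /andP[a2A a3A] /eqP e.
exists (a1, a2, a3, a4) => //; rewrite inE a1A a2A a3A a4A /=; apply/eqP.
have -> : a1 = a2 + x * a3 - x * a4 by rewrite -e; ring.
ring.
Qed.

Lemma energy_le_cube A x : (energy A x <= #|A| ^ 3)%N.
Proof.
pose f (t : F * F * F * F) := let: (a1, a2, a3, a4) := t in (a2, (a3, a4)).
have -> : (#|A| ^ 3 = #|setX A (setX A A)|)%N by rewrite !cardsX !expnS expn0 muln1.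
rewrite /energy -(@card_in_imset _ _ f).
  apply/subset_leq_card/subsetP=> z /imsetP[[[[b1 b2] b3] b4] tE ->]; move: tE.
  by rewrite inE => /and5P[_ b2A b3A b4A _]; rewrite !in_setX b2A b3A b4A.
move=> [[[a1 a2] a3] a4] [[[b1 b2] b3] b4]; rewrite !inE.
case/and5P=> _ _ _ _ /eqP ea /and5P[_ _ _ _ /eqP eb] [e2 e3 e4].
move: ea eb; rewrite e2 e3 e4 => ea eb.
by have -> : a1 = b1 by apply: (addIr (- b2)); rewrite ea eb.
Qed.

(** Cauchy-Schwarz over the fibers of [(a, c) |-> a + x * c] on [A * A]. *)
Lemma energy_ge A x :
  #|A|%:R ^+ 4 <= (energy A x)%:R * #|sumset A (dilate x A)|%:R :> R.
Proof.
pose f (p : F * F) := p.1 + x * p.2; pose I := sumset A (dilate x A).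
pose r s := #|[set p in setX A A | f p == s]|.
have fI : {in setX A A, forall p, f p \in I}.
  by move=> [a b]; rewrite in_setX => /andP[aA bA]; rewrite mem_sumset // mem_dilate.
have E1 : (#|A| ^ 2 = \sum_(s in I) r s)%N by rewrite -(card_fibers fI) cardsX expnS expn1.
have E2 : (\sum_(s in I) r s ^ 2 <= energy A x)%N.
  rewrite energy_collisions_sum (card_collisions f).
  by rewrite [leqRHS](bigID (mem I)) /= leq_addr.
have := @sum_sqr_ge R _ I (fun s => (r s)%:R).
rewrite -natr_sum -E1 natrX -exprM => /le_trans; apply; rewrite mulrC.
apply: ler_wpM2r => //; apply: le_trans (_ : (\sum_(s in I) r s ^ 2)%:R <= _).
  by rewrite natr_sum; apply: ler_sum => s _; rewrite natrX.
by rewrite ler_nat.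
Qed.

(** A quadruple with [a3 != a4] determines [y], so it is counted at most once. If [a3 = a4] then
    [a1 = a2], and these [|A|^2] quadruples occur for every [y]. *)
Lemma sum_energy_le A (k : {set F}) : 
  (\sum_(y in k) energy A y <= #|k| * #|A| ^ 2 + #|A| ^ 4)%N.
Proof.
pose T := setX (setX (setX A A) A) A.
have cT : #|T| = (#|A| ^ 4)%N by rewrite !cardsX !expnS expn0 muln1 !mulnA.
pose f (t : F * F * F * F) := let: (a1, a2, a3, a4) := t in (a1 - a2) / (a3 - a4).
pose T0 := [set t : F * F * F * F | let: (a1, a2, a3, a4) := t in
   [&& a1 \in A, a3 \in A, a1 == a2 & a3 == a4]].
have cT0 : (#|T0| <= #|A| ^ 2)%N.
  pose g (p : F * F) := (p.1, p.1, p.2, p.2).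
  rewrite expnS expn1 -cardsX; apply: leq_trans (leq_imset_card g _).
  apply/subset_leq_card/subsetP=> -[[[a1 a2] a3] a4]; rewrite inE.
  case/and4P=> a1A a3A /eqP <- /eqP <-; apply/imsetP.
  by exists (a1, a3); rewrite ?in_setX ?a1A.
have step y : (energy A y <= #|A| ^ 2 + #|[set t in T | f t == y]|)%N.
  apply: leq_trans (leq_add cT0 (leqnn _)); apply: leq_trans (leq_card_setU _ _).
  apply/subset_leq_card/subsetP=> -[[[a1 a2] a3] a4]; rewrite !inE /=.
  case/and5P=> a1A a2A a3A a4A /eqP e; rewrite a1A a2A a3A a4A /=.
  have [a34|a34] := eqVneq a3 a4.
    by move: e; rewrite a34 subrr mulr0 => /subr0_eq ->; rewrite eqxx.
  by rewrite e mulfK ?subr_eq0 // eqxx orbT.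
apply: leq_trans (leq_sum _ (fun y _ => step y)) _.
rewrite big_split /= sum_nat_const leq_add2l -cT.
rewrite (@card_fibers _ _ f T [set: F]); last by move=> t _; rewrite in_setT.
rewrite [leqRHS](bigID (mem k)) /=.
apply: leq_trans (leq_addr _ _); apply: eq_leq; apply: eq_bigl => y.
by rewrite in_setT.
Qed.

End Energy.

(** * The generated subfield *)

Section GeneratedField.
Variable F : finFieldType.
Implicit Types (X S : {set F}) (x y z : F).

(* The closure of [0] under [y |-> x * y] and [y |-> y + x] for [x] in [X]; it is
   the subfield generated by [X] when [0 \notin X]. *)
Definition genfield X : {set F} :=
  [set y | connect (fun y z => [exists x in X, (z == x * y) || (z == y + x)]) 0 y].

Lemma genfield0 X : 0 \in genfield X.
Proof. by rewrite inE connect0. Qed.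

Lemma genfield_stepM X x y : x \in X -> y \in genfield X -> x * y \in genfield X.
Proof.
rewrite !inE => xX /connect_trans; apply; apply: connect1.
by apply/existsP; exists x; rewrite xX eqxx.
Qed.

Lemma genfield_stepD X x y : x \in X -> y \in genfield X -> y + x \in genfield X.
Proof.
rewrite !inE => xX /connect_trans; apply; apply: connect1.
by apply/existsP; exists x; rewrite xX eqxx orbT.
Qed.

Lemma genfield_ind X (P : F -> Prop) :
    P 0 ->
    (forall x y, x \in X -> y \in genfield X -> P y -> P (x * y) /\ P (y + x)) ->
  forall y, y \in genfield X -> P y.
Proof.
move=> P0 Pstep y; rewrite inE => /connectP[p].
have := genfield0 X; elim: p (0 : F) P0 => [|z p IHp] a Pa aX /=; first by move=> _ ->.
case/andP=> /existsP[x /andP[xX /orP e]] pth yE.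
have [Pm Pd] := Pstep x a xX aX Pa.
by case: e => /eqP ze; apply: IHp pth yE; rewrite ze ?genfield_stepM ?genfield_stepD.
Qed.

Lemma genfield_sub X : X \subset genfield X.
Proof.
by apply/subsetP=> x xX; rewrite -[x]add0r genfield_stepD ?genfield0.
Qed.

Section Closure.
Variable X : {set F}.
Hypothesis X0 : 0 \notin X.
Let k := genfield X.

(** Multiplication by [x] maps the finite set [k] injectively into itself, hence onto. *)
Lemma genfield_divX x y : x \in X -> y \in k -> exists2 z, z \in k & y = x * z.
Proof.
move=> xX yk; have x0 : x != 0 by apply: contraNneq X0 => <-.
have sub : dilate x k \subset k.
  by apply/subsetP=> _ /imsetP[z zk ->]; apply: genfield_stepM.
have /eqP E : dilate x k == k by rewrite eqEcard sub card_dilate /=.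
have : y \in dilate x k by rewrite E.
by case/imsetP=> z zk ->; exists z.
Qed.

Lemma genfieldD y z : y \in k -> z \in k -> y + z \in k.
Proof.
move=> yk zk; move: y yk.
(* The first summand stays arbitrary in the induction, because the multiplicative step reads
   [y + x * t = x * (y / x + t)] and changes it. *)
apply: (genfield_ind (P := fun z => forall y, y \in k -> y + z \in k)) zk => [y|x t xX tk IH].
  by rewrite addr0.
split=> y yk; last by rewrite addrA genfield_stepD // IH.
have [y' y'k ->] := genfield_divX xX yk.
by rewrite -mulrDr genfield_stepM // IH.
Qed.

Lemma genfieldM y z : y \in k -> z \in k -> y * z \in k.
Proof.
move=> yk zk; apply: (genfield_ind (P := fun y => y * z \in k)) yk => [|x t xX tk IH].
  by rewrite mul0r genfield0.
split; first by rewrite -mulrA genfield_stepM.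
by rewrite mulrDl genfieldD // genfield_stepM.
Qed.

Lemma genfieldN y : y \in k -> - y \in k.
Proof.
move=> yk; have sub : (fun z => z + y) @: k \subset k.
  by apply/subsetP=> _ /imsetP[z zk ->]; apply: genfieldD.
have /eqP E : (fun z => z + y) @: k == k.
  by rewrite eqEcard sub card_imset /=; last exact: addIr.
have : 0 \in (fun z => z + y) @: k by rewrite E genfield0.
case/imsetP=> z zk /esym/eqP.
by rewrite addr_eq0 => /eqP <-.
Qed.

Lemma genfieldB y z : y \in k -> z \in k -> y - z \in k.
Proof. by move=> yk zk; rewrite genfieldD ?genfieldN. Qed.

End Closure.

(** A discrete intermediate value principle: if no [y] fell in the window, [f y <= c] would always
    force [b * f y <= c], and the bound [f <= c] would spread from [0] to the whole field. *)
Lemma genfield_crossing (R : realFieldType) X (f : F -> R) (b c : R) :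
    (forall x y, x \in X -> y \in genfield X ->
       f (x * y) <= b * f y /\ f (y + x) <= b * f y) ->
    f 0 <= c -> (exists2 y, y \in genfield X & c < f y) ->
  exists2 y, y \in genfield X & f y <= c < b * f y.
Proof.
move=> fstep f0 [y1 y1k cy1].
case: (pickP [pred y in genfield X | f y <= c < b * f y]) => [y /andP[yk yP]|none].
  by exists y.
suff : f y1 <= c by rewrite leNgt cy1.
apply: (genfield_ind (P := fun y => f y <= c)) y1k => // x y xX yk yc.
have bc : b * f y <= c by have := none y; rewrite /= yk yc /= ltNge => /negbFE.
have [fm fd] := fstep x y xX yk.
by split; apply: le_trans bc.
Qed.

End GeneratedField.

(** The pair [(w, x * w)] with [w != 0] determines [x], so all these pairs are distinct elements of
    [P * P]. *)
Lemma card_ratio_pairs (F : finFieldType) (X P : {set F}) :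
  (\sum_(x in X) #|[set w in P :\ 0%R | (x * w)%R \in P]| <= #|P| ^ 2)%N.
Proof.
pose f (p : F * F) := p.2 / p.1.
rewrite expnS expn1 -cardsX (@card_fibers _ _ f (setX P P) [set: F]); last first.
  by move=> p _; rewrite in_setT.
rewrite [leqRHS](bigID (mem X)) /=; apply: leq_trans (leq_addr _ _).
rewrite [leqRHS](eq_bigl (mem X)) => [|x]; last by rewrite in_setT.
apply: leq_sum => x xX; have inj : injective (fun w => (w, x * w)) by move=> ? ? [].
rewrite -(card_imset _ inj); apply/subset_leq_card/subsetP=> _ /imsetP[w wP ->].
move: wP; rewrite !inE /f /= => /andP[/andP[w0 wP] xwP].
by rewrite wP xwP mulfK // eqxx.
Qed.

Lemma imset2_rep (T1 T2 T : finType) (f : T1 -> T2 -> T) (A : {set T1}) (B : {set T2}) (p0 : T1 * T2) :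
  exists r : T -> T1 * T2, forall d, d \in [set f a b | a in A, b in B] ->
    [/\ (r d).1 \in A, (r d).2 \in B & f (r d).1 (r d).2 = d].
Proof.
exists (fun d => odflt p0 [pick p | [&& p.1 \in A, p.2 \in B & f p.1 p.2 == d]]) => d.
case/imset2P=> a b aA bB ->; case: pickP => [p /and3P[? ? /eqP]|/(_ (a, b))] //=.
by rewrite aA bB eqxx.
Qed.

(** * Subsets of the generated field commensurable with their dilates *)

Section SubsetOfGeneratedField.
Variables (R : realFieldType) (F : finFieldType) (X U : {set F}) (b kappa : R).
Hypotheses (X0 : 0 \notin X) (b_ge1 : 1 <= b) (U0 : U != set0).
Hypothesis Uk : U \subset genfield X.
Hypothesis growth : forall x, x \in X ->
  #|diffset (sumset U (dilate x U)) U|%:R <= b * #|U|%:R.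
Hypothesis doubling : #|diffset (sumset U U) U|%:R <= kappa * #|U|%:R.

Let k := genfield X.
Let g y : R := #|sumset U (dilate y U)|%:R.

Lemma generator_neq0 x : x \in X -> x != 0.
Proof. by move=> xX; apply: contraNneq X0 => <-. Qed.

Lemma card_U_gt0 : 0 < #|U|%:R :> R.
Proof. by rewrite ltr0n card_gt0. Qed.

Lemma dilate_neq0 x (A : {set F}) : A != set0 -> dilate x A != set0.
Proof. by case/set0Pn=> a aA; apply/set0Pn; exists (x * a); rewrite mem_dilate. Qed.

Lemma card_diff_dilate x : x \in X -> #|diffset (dilate x U) U|%:R <= b * #|U|%:R.
Proof.
move=> xX; apply: le_trans (growth xX); rewrite ler_nat !diffsetE -sumsetA.
by rewrite [sumset U _]sumsetC card_sumset_ge.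
Qed.

(** Ruzsa's inequality through [x * U]: the set [x * U + x * y * U] is a dilate of [U + y * U]. *)
Lemma card_sumset_stepM x y : x \in X -> g (x * y) <= b * g y.
Proof.
move=> xX; have x0 := generator_neq0 xX.
have := ruzsa_sum U (dilate x U) (dilate (x * y) U).
rewrite -dilate_dilate -dilate_sumset !card_dilate // card_diffsetC -(ler_nat R) !natrM.
rewrite dilate_dilate => H; rewrite -(ler_pM2r card_U_gt0); apply: le_trans H _.
rewrite [_ * g y * _]mulrAC ler_wpM2r ?ler0n //.
exact: card_diff_dilate.
Qed.

(** [U + (y + x) * U] is contained in [(U + x * U) + y * U]. The extra [- U] in [growth] is what
    lets Ruzsa's inequality replace [U + x * U] by [U]. *)
Lemma card_sumset_stepD x y : x \in X -> g (y + x) <= b * g y.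
Proof.
move=> xX; have := ruzsa_sum (sumset U (dilate x U)) U (dilate y U).
rewrite -(ler_nat R) !natrM => H.
rewrite -(ler_pM2r card_U_gt0); apply: le_trans (le_trans (_ : _ <= _) H) _.
  rewrite ler_wpM2r // ler_nat; apply/subset_leq_card/subsetP=> z.
  case/imset2P=> u _ uU /imsetP[v vU ->] ->.
  have -> : u + (y + x) * v = u + x * v + y * v by ring.
  by rewrite !mem_sumset ?mem_dilate.
by rewrite [_ * g y * _]mulrAC ler_wpM2r ?ler0n // growth.
Qed.

Lemma card_sumset_dilate0 : g 0 = #|U|%:R.
Proof.
congr (_%:R); apply: eq_card => z; apply/imset2P/idP => [[u _ uU /imsetP[v vU ->] ->]|zU].
  by rewrite mul0r addr0.
by exists z 0; rewrite ?addr0 //; apply/imsetP; exists z; rewrite ?mul0r.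
Qed.

Lemma sumset_genfield y : y \in k -> sumset U (dilate y U) \subset k.
Proof.
move=> yk; apply/subsetP=> _ /imset2P[u _ uU /imsetP[v vU ->] ->].
by rewrite genfieldD ?genfieldM // (subsetP Uk).
Qed.

(* [y] of minimal energy: the average of [energy U y] over nonzero [y] in [k]
   is at most [#|U|^2 + #|U|^4 / (#|k| - 1)]. *)
Lemma exists_expander : (1 < #|k|)%N -> exists2 y, y \in k &
  (#|k|%:R - 1) * #|U|%:R ^+ 2 <= g y * (#|k|%:R - 1 + #|U|%:R ^+ 2).
Proof.
move=> k_gt1; pose k' := k :\ 0.
have k'E : #|k'|%:R = #|k|%:R - 1 :> R.
  by rewrite [in RHS](cardsD1 0) genfield0 natrD -/k' addrAC subrr add0r.
have k'_gt0 : 0 < #|k|%:R - 1 :> R by rewrite subr_gt0 ltr1n.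
have /card_gt0P[y0 y0k'] : (0 < #|k'|)%N by rewrite -(ltr0n R) k'E.
case: (@arg_minnP _ y0 (mem k') (energy U) y0k') => y yk' ymin.
have /setD1P[_ yk] := yk'.
exists y => //; have low : (#|k'| * energy U y <= \sum_(y in k') energy U y)%N.
  by rewrite -sum_nat_const leq_sum.
have up : (#|k|%:R - 1) * (energy U y)%:R <=
    (#|k|%:R - 1) * #|U|%:R ^+ 2 + #|U|%:R ^+ 4 :> R.
  rewrite -k'E -!natrX -!natrM -natrD ler_nat.
  exact: leq_trans low (sum_energy_le U k').
have E := energy_ge R U y; rewrite -/(g y) in E.
have u_gt0 : 0 < #|U|%:R ^+ 2 :> R by rewrite exprn_gt0 ?card_U_gt0.
rewrite -(ler_pM2r u_gt0); set m := _ - 1 in k'_gt0 up *.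
have H1 : m * #|U|%:R ^+ 4 <= m * ((energy U y)%:R * g y).
  by apply: ler_wpM2l E; apply: ltW.
have H2 : m * ((energy U y)%:R * g y) <= (m * #|U|%:R ^+ 2 + #|U|%:R ^+ 4) * g y.
  by rewrite mulrA; apply: ler_wpM2r up; apply: ler0n.
have -> : m * #|U|%:R ^+ 2 * #|U|%:R ^+ 2 = m * #|U|%:R ^+ 4 :> R by ring.
apply: le_trans H1 (le_trans H2 _).
by rewrite le_eqVlt; apply/orP; left; apply/eqP; ring.
Qed.

(* If [g y] is well below [#|U|^2] then [U] and [y U] have a large common
   difference set [P], but [P] is small, and each [x] in [X] is a quotient of
   many pairs of elements of [P]. *)
Lemma card_le_of_intersection y : y \in k ->
    g y <= #|U|%:R ^+ 2 / (4 * b ^+ 2) < b * g y ->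
  #|X|%:R <= 32 * kappa ^+ 4 * b ^+ 5.
Proof.
move=> yk /andP[g_le g_gt].
have u_gt0 := card_U_gt0; have b_gt0 : 0 < b by apply: lt_le_trans b_ge1.
have g_gt0 : 0 < g y.
  by apply: lt_le_trans u_gt0 _; rewrite ler_nat card_sumset_ge ?dilate_neq0.
pose f (p : F * F) := p.1 + y * p.2.
have fI : {in setX U U, forall p, f p \in sumset U (dilate y U)}.
  by move=> [u v]; rewrite in_setX => /andP[uU vU]; rewrite mem_sumset ?mem_dilate.
have UU0 : setX U U != set0.
  by case/set0Pn: U0 => u uU; apply/set0Pn; exists (u, u); rewrite in_setX uU.
have [s sI] := large_fiber UU0 fI; set W := [set p in _ | _].
rewrite cardsX -(ler_nat R) !natrM -/(g y) -expr2 => cW.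
pose P := [set w in diffset U U | y * w \in diffset U U].
(* With [d = u + y * v] a fixed representation, [(w, d)] goes to [(u + y * w, v - w)]; the first
   entry plus [y] times the second gives back [d]. *)
have cP : #|P|%:R * g y <= (kappa * #|U|%:R) ^+ 2.
  have [r rP] := imset2_rep (fun a c => a + y * c) U U (0, 0).
  have dE d : d \in sumset U (dilate y U) -> d \in [set a + y * c | a in U, c in U].
    by case/imset2P=> u _ uU /imsetP[v vU ->] ->; apply: imset2_f.
  apply: le_trans (_ : #|diffset (sumset U U) U|%:R ^+ 2 <= _); last first.
    by apply: ler_pM => //; apply: ler0n.
  rewrite -natrM -natrX ler_nat expnS expn1 -!cardsX.
  pose h (p : F * F) := ((r p.2).1 + y * p.1, (r p.2).2 - p.1).
  rewrite -(@card_in_imset _ _ h).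
    apply/subset_leq_card/subsetP=> _ /imsetP[[w d] /setXP[wP /dE/rP[r1 r2 rd]] ->].
    move: wP; rewrite inE => /andP[/imset2P[a c aU cU wE] /imset2P[a' c' a'U c'U ywE]].
    rewrite in_setX /= ywE wE opprB !addrA mem_diffset ?mem_sumset //=.
    by rewrite mem_diffset ?mem_sumset.
  move=> [w d] [w' d'] /setXP[_ /dE/rP[_ _ rd]] /setXP[_ /dE/rP[_ _ rd']] [/= e1 e2].
  have dd : d = d'.
    rewrite -rd -rd'.
    have -> : (r d).1 + y * (r d).2 = ((r d).1 + y * w) + y * ((r d).2 - w) by ring.
    by rewrite e1 e2; ring.
  by move: e2; rewrite dd => /addrI/oppr_inj ->.
(* Pigeonhole on [W * U * U]: fixing [x * p2 - q1] and [x * p1 - q2], of which there are at most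
   [(b * |U|)^2] values, leaves a fiber of size at least [|W| / b^2]. For two points of the fiber,
   let [w] be the increment of [p2]. Then [w], [y * w], [x * w] and [y * x * w] are all differences
   of [U], so both [w] and [x * w] lie in [P]. *)
have Nx x : x \in X -> #|W|%:R <= b ^+ 2 * #|[set w in P | x * w \in P]|%:R :> R.
  move=> xX; pose D := setX W (setX U U).
  pose h (p : (F * F) * (F * F)) := (x * p.1.2 - p.2.1, x * p.1.1 - p.2.2).
  pose I := setX (diffset (dilate x U) U) (diffset (dilate x U) U).
  have hI : {in D, forall p, h p \in I}.
    move=> [[p1 p2] [q1 q2]] /setXP[]; rewrite inE => /andP[/setXP[p1U p2U] _] /setXP[q1U q2U].
    by rewrite in_setX !mem_diffset ?mem_dilate.
  have W_gt0 : (0 < #|W|)%N.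
    have : 0 < g y * #|W|%:R by apply: lt_le_trans cW; rewrite exprn_gt0.
    by rewrite pmulr_rgt0 // ltr0n.
  have D0 : D != set0 by rewrite -card_gt0 !cardsX !muln_gt0 W_gt0 !card_gt0 U0.
  have [t tI] := large_fiber D0 hI; set V := [set p in _ | _] => cD.
  have : #|W|%:R * #|U|%:R ^+ 2 <= (b * #|U|%:R) ^+ 2 * #|V|%:R :> R.
    apply: le_trans (_ : #|I|%:R * #|V|%:R <= _).
      by move: cD; rewrite -(ler_nat R) !cardsX !natrM -expr2.
    rewrite ler_wpM2r ?ler0n // cardsX natrM.
    by apply: ler_pM; rewrite ?ler0n // card_diff_dilate.
  rewrite exprMn mulrAC ler_pM2r ?exprn_gt0 // => /le_trans; apply.
  apply: ler_wpM2l; [by apply/exprn_ge0/ltW|rewrite ler_nat].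
  have [->|/set0Pn[p0 p0V]] := eqVneq V set0; first by rewrite cards0.
  have VP p : p \in V -> [/\ p.1.1 \in U, p.1.2 \in U, p.2.1 \in U, p.2.2 \in U &
     [/\ p.1.1 + y * p.1.2 = s, x * p.1.2 - p.2.1 = t.1 & x * p.1.1 - p.2.2 = t.2]].
    case: p => [[p1 p2] [q1 q2]] /=; rewrite inE => /andP[/setXP[]].
    rewrite inE => /andP[/setXP[p1U p2U] /eqP fs] /setXP[q1U q2U] /eqP ht.
    by rewrite -ht.
  have [u1 u2 u3 u4 [us ut1 ut2]] := VP _ p0V.
  rewrite -(@card_in_imset _ _ (fun p => p.1.2 - p0.1.2)).
    apply/subset_leq_card/subsetP=> _ /imsetP[p pV ->].
    have [v1 v2 v3 v4 [vs vt1 vt2]] := VP _ pV.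
    have e1 : y * (p.1.2 - p0.1.2) = p0.1.1 - p.1.1.
      have -> : p.1.1 = s - y * p.1.2 by rewrite -vs; ring.
      have -> : p0.1.1 = s - y * p0.1.2 by rewrite -us; ring.
      ring.
    have e2 : x * (p.1.2 - p0.1.2) = p.2.1 - p0.2.1.
      have -> : p.2.1 = x * p.1.2 - t.1 by rewrite -vt1; ring.
      have -> : p0.2.1 = x * p0.1.2 - t.1 by rewrite -ut1; ring.
      ring.
    have e3 : y * (x * (p.1.2 - p0.1.2)) = p0.2.2 - p.2.2.
      rewrite mulrCA e1.
      have -> : p.2.2 = x * p.1.1 - t.2 by rewrite -vt2; ring.
      have -> : p0.2.2 = x * p0.1.1 - t.2 by rewrite -ut2; ring.
      ring.
    by rewrite !inE e3 e2 e1 !mem_diffset.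
  move=> p p' /VP[_ _ _ _ [vs vt1 vt2]] /VP[_ _ _ _ [vs' vt1' vt2']] /addIr e.
  have e1 : p.1.1 = p'.1.1 by apply: (addIr (y * p.1.2)); rewrite vs e vs'.
  have e2 : p.2.1 = p'.2.1.
    by apply: oppr_inj; apply: (addrI (x * p.1.2)); rewrite vt1 e vt1'.
  have e3 : p.2.2 = p'.2.2.
    by apply: oppr_inj; apply: (addrI (x * p.1.1)); rewrite vt2 e1 vt2'.
  case: p e e1 e2 e3 {vs vt1 vt2} => [[? ?] [? ?]] /=.
  by case: p' {vs' vt1' vt2'} => [[? ?] [? ?]] /= -> -> -> ->.
(* [G] is the mean number of representations [u + y * v]; the window for [g y] says that it lies
   between [4 * b^2] and [4 * b^3]. *)
pose G := #|U|%:R ^+ 2 / g y.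
have GE : G * g y = #|U|%:R ^+ 2 by rewrite divfK ?gt_eqF.
have b2_gt0 : 0 < b ^+ 2 by apply: exprn_gt0.
have b2_ge1 : 1 <= b ^+ 2 by apply: exprn_ege1.
have G_ge : 4 * b ^+ 2 <= G.
  by rewrite -(ler_pM2r g_gt0) GE mulrC -ler_pdivlMr // mulr_gt0.
have G_le : G <= 4 * b ^+ 3.
  rewrite -(ler_pM2r g_gt0) GE; move/ltW: g_gt.
  rewrite ler_pdivrMr ?mulr_gt0 // => /le_trans; apply.
  by rewrite le_eqVlt; apply/orP; left; apply/eqP; ring.
have cP' : #|P|%:R <= kappa ^+ 2 * G.
  by rewrite -(ler_pM2r g_gt0) -mulrA GE -exprMn.
have cX : #|X|%:R * (G / (2 * b ^+ 2)) <= #|P|%:R ^+ 2 :> R.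
  have := card_ratio_pairs X P; rewrite -(ler_nat R) natrX natr_sum => /(le_trans _); apply.
  rewrite mulrC mulr_natr -sumr_const; apply: ler_sum => x xX.
  have := Nx x xX; set N := (X in _ <= b ^+ 2 * X) => HN.
  have GW : G <= #|W|%:R by rewrite -(ler_pM2r g_gt0) GE mulrC.
  (* Quotients exclude [w = 0]. The loss of 1 is harmless because [G / b^2] is at least 4. *)
  have N1 : N - 1 <= #|[set w in P :\ 0 | x * w \in P]|%:R.
    rewrite lerBlDr /N natr1 ler_nat.
    rewrite (cardsD1 0 [set w in P | x * w \in P]) -add1n.
    apply: leq_add; first by case: (_ \in _).
    apply: subset_leq_card; apply/subsetP=> w /setD1P[w0].
    by rewrite in_set => /andP[wP xwP]; rewrite in_set in_setD1 w0 wP xwP.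
  apply: le_trans N1; rewrite ler_pdivrMr ?mulr_gt0 //.
  have := le_trans GW HN; nra.
have k2_ge0 : 0 <= kappa ^+ 2 * G by apply: le_trans cP'; apply: ler0n.
have cX' : #|X|%:R * (G / (2 * b ^+ 2)) <= (kappa ^+ 2 * G) ^+ 2 :> R.
  by apply: le_trans cX _; apply: ler_pM; rewrite ?ler0n.
have G_gt0 : 0 < G by apply: lt_le_trans G_ge; rewrite mulr_gt0.
have : #|X|%:R <= 2 * b ^+ 2 * kappa ^+ 4 * G.
  rewrite -(ler_pM2r (divr_gt0 G_gt0 (mulr_gt0 (ltr0n _ 2) b2_gt0))).
  apply: le_trans cX' _; rewrite le_eqVlt; apply/orP; left; apply/eqP; field.
  by rewrite gt_eqF.
have k4_ge0 : 0 <= kappa ^+ 4 by apply: exprn_even_ge0.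
have b5_ge0 : 0 <= b ^+ 5 by apply/exprn_ge0/ltW.
move/le_trans; apply.
apply: le_trans (_ : 2 * b ^+ 2 * kappa ^+ 4 * (4 * b ^+ 3) <= _).
  by apply: ler_wpM2l => //; apply: mulr_ge0 => //; apply: mulr_ge0 => //; apply: ltW.
have -> : 2 * b ^+ 2 * kappa ^+ 4 * (4 * b ^+ 3) = 8 * (kappa ^+ 4 * b ^+ 5) by ring.
have : 0 <= kappa ^+ 4 * b ^+ 5 by apply: mulr_ge0.
by rewrite -mulrA; move: (kappa ^+ 4 * b ^+ 5) => z; lra.
Qed.

(* Dual to the previous lemma: for a sparse enough [Q = U + y U], every [x] in
   [X] exceeds the mean energy [#|Q|^4 / #|k|] by a fixed proportion of
   [#|Q|^3], whereas the excesses of all elements of [k] sum up to at most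
   [2 * #|k| * #|Q|^2]. *)
Lemma card_le_of_sumset y : y \in k ->
    g y <= #|k|%:R / (8 * b ^+ 2) < b * g y ->
  #|X|%:R <= 19 * b ^+ 5.
Proof.
move=> yk /andP[g_le g_gt].
have u_gt0 := card_U_gt0; have b_gt0 : 0 < b by apply: lt_le_trans b_ge1.
have b2_gt0 : 0 < b ^+ 2 by apply: exprn_gt0.
have b2_ge1 : 1 <= b ^+ 2 by apply: exprn_ege1.
set Q := sumset U (dilate y U); pose q : R := #|Q|%:R.
have q_gt0 : 0 < q.
  by apply: lt_le_trans u_gt0 _; rewrite ler_nat card_sumset_ge ?dilate_neq0.
have Qk : Q \subset k by apply: sumset_genfield.
have qk : q <= #|k|%:R by rewrite ler_nat subset_leq_card.
(* [Q + x * Q] equals [(U + x * U) + y * (U + x * U)]; [growth] removes the two copies of [x * U] in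
   turn, each for a factor [b]. *)
have growQ x : x \in X -> #|sumset Q (dilate x Q)|%:R <= b ^+ 2 * q.
  move=> xX; have -> : sumset Q (dilate x Q) =
      sumset (sumset U (dilate x U)) (sumset (dilate y U) (dilate y (dilate x U))).
    rewrite /Q dilate_sumset !sumsetA [dilate x (dilate y U)]dilate_dilate mulrC -dilate_dilate.
    by congr sumset; rewrite sumsetAC.
  have := ruzsa_sum (sumset U (dilate x U)) U (dilate y (sumset U (dilate x U))).
  rewrite dilate_sumset -(ler_nat R) !natrM => H1.
  rewrite -(ler_pM2r u_gt0); apply: le_trans H1 _.
  apply: le_trans (ler_wpM2r (ler0n _ _) (growth xX)) _.
  rewrite mulrAC ler_pM2r // -mulrA ler_pM2l // sumsetC.
  have [y0|y0] := eqVneq y 0.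
    have -> : sumset (sumset (dilate y U) (dilate y (dilate x U))) U = Q.
      rewrite /Q sumsetC y0; congr sumset; apply/setP=> z; apply/imset2P/imsetP.
        case=> _ _ /imsetP[u uU ->] /imsetP[v vU ->] ->.
        by exists u; rewrite ?mul0r ?addr0.
      case=> u uU ->; exists (0 * u) (0 * (x * u)); rewrite ?mem_dilate ?mem_dilate //.
      by rewrite !mul0r addr0.
    by apply: ler_peMl => //; apply: ltW.
  have := ruzsa_sum (sumset (dilate y U) (dilate y (dilate x U))) (dilate y U) U.
  rewrite -dilate_sumset -(ler_nat R) !natrM card_dilate // => H1.
  rewrite -(ler_pM2r u_gt0); apply: le_trans H1 _.
  rewrite mulrAC [sumset _ U]sumsetC; apply: ler_wpM2r => //.
  rewrite diffsetE dilate_dilate mulrC -dilate_dilate -dilate_sumset card_dilate //.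
  by rewrite -diffsetE growth.
have c_gt0 : 0 < #|k|%:R :> R by apply: lt_le_trans qk.
have high x : x \in X -> q ^+ 3 / b ^+ 2 <= (energy Q x)%:R.
  move=> xX; rewrite ler_pdivrMr // -(ler_pM2r q_gt0) -exprSr.
  apply: le_trans (energy_ge R Q x) _; rewrite -mulrA.
  by apply: ler_wpM2l; rewrite ?growQ.
have low x : x \in k -> q ^+ 4 / #|k|%:R <= (energy Q x)%:R.
  move=> xk; rewrite ler_pdivrMr //; apply: le_trans (energy_ge R Q x) _.
  apply: ler_wpM2l => //; rewrite ler_nat; apply: subset_leq_card.
  apply/subsetP=> _ /imset2P[u _ uQ /imsetP[v vQ ->] ->].
  by rewrite genfieldD ?genfieldM // (subsetP Qk).
have Xk : X \subset k by apply: genfield_sub.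
pose k' := k :\ 0; have Xk' : X \subset k'.
  by apply/subsetP=> x xX; rewrite in_setD1 generator_neq0 // (subsetP Xk).
have k'E : #|k'|%:R = #|k|%:R - 1 :> R.
  by rewrite [in RHS](cardsD1 0) genfield0 natrD -/k' addrAC subrr add0r.
have up : \sum_(x in k') (energy Q x)%:R <= (#|k|%:R - 1) * q ^+ 2 + q ^+ 4 :> R.
  by rewrite -k'E -natr_sum -!natrX -natrM -natrD ler_nat sum_energy_le.
have split : \sum_(x in k') (energy Q x)%:R >=
    #|X|%:R * (q ^+ 3 / b ^+ 2) + (#|k|%:R - 1 - #|X|%:R) * (q ^+ 4 / #|k|%:R) :> R.
  rewrite (bigID (mem X)) /=; apply: lerD.
    rewrite mulr_natl -sumr_const.
    rewrite [leRHS](eq_bigl (mem X)) => [|x]; first exact: ler_sum.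
    by rewrite andb_idl // => /(subsetP Xk').
  have -> : #|k|%:R - 1 - #|X|%:R = #|k' :\: X|%:R :> R.
    by rewrite cardsD (setIidPr Xk') natrB ?subset_leq_card // k'E.
  rewrite mulr_natl -sumr_const.
  rewrite [leRHS](eq_bigl (mem (k' :\: X))) => [|x]; last by rewrite !inE andbC.
  by apply: ler_sum => x /setDP[/setD1P[_ xk] _]; apply: low.
have qsmall : q ^+ 4 / #|k|%:R <= q ^+ 3 / b ^+ 2 / 8.
  rewrite ler_pdivrMr // -ler_pdivrMl ?divr_gt0 ?exprn_gt0 //.
  have -> : (q ^+ 3 / b ^+ 2 / 8)^-1 * q ^+ 4 = q * (8 * b ^+ 2).
    by field; rewrite !gt_eqF.
  by rewrite -ler_pdivlMr // mulr_gt0.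
have q4 : q ^+ 4 / #|k|%:R <= #|k|%:R * q ^+ 2.
  rewrite ler_pdivrMr //.
  have -> : q ^+ 4 = q ^+ 2 * q ^+ 2 by rewrite -exprD.
  rewrite [leRHS]mulrAC; apply: ler_wpM2r; first by apply/exprn_ge0/ltW.
  by rewrite expr2; apply: ler_pM => //; apply: ltW.
(* Summed over the field, the baseline [q^4 / |k|] cancels the [q^4] of [up]; by [qsmall] each [x]
   in [X] retains at least 7/8 of [q^3 / b^2]. With [|k| <= 8 * b^3 * q] this gives the constant
   [128 / 7], rounded up to 19. *)
have key : #|X|%:R * (q ^+ 3 / b ^+ 2) * (7 / 8) <= 2 * #|k|%:R * q ^+ 2.
  have H0 := le_trans split up.
  have H1 : #|k|%:R * (q ^+ 4 / #|k|%:R) = q ^+ 4.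
    by rewrite mulrCA divff ?gt_eqF // mulr1.
  have H2 : #|X|%:R * (q ^+ 4 / #|k|%:R) <= #|X|%:R * (q ^+ 3 / b ^+ 2 / 8).
    by apply: ler_wpM2l qsmall.
  have H3 : 0 <= q ^+ 2 by apply/exprn_ge0/ltW.
  move: H0 H1 H2 H3 q4; rewrite {qsmall split up}.
  set a := q ^+ 4 / _; set c := q ^+ 3 / _; set d := q ^+ 2; set e := q ^+ 4.
  move: a c d e #|X|%:R #|k|%:R => a c d e x n; lra.
have g_gt' : #|k|%:R <= 8 * b ^+ 3 * q.
  move/ltW: g_gt; rewrite ler_pdivrMr ?mulr_gt0 // => /le_trans; apply.
  by rewrite le_eqVlt; apply/orP; left; apply/eqP; rewrite /q /Q -/(g y); ring.
have q2_gt0 : 0 < q ^+ 2 * q / b ^+ 2 by rewrite divr_gt0 ?mulr_gt0 ?exprn_gt0.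
rewrite -(ler_pM2r q2_gt0).
have e5 : 19 * b ^+ 5 * (q ^+ 2 * q / b ^+ 2) = 19 / 8 * (8 * b ^+ 3 * q * q ^+ 2).
  by field; rewrite gt_eqF.
have -> : #|X|%:R * (q ^+ 2 * q / b ^+ 2) = #|X|%:R * (q ^+ 3 / b ^+ 2) by rewrite -exprSr.
rewrite {}e5; have : #|k|%:R * q ^+ 2 <= 8 * b ^+ 3 * q * q ^+ 2.
  by apply: ler_wpM2r; rewrite ?sqr_ge0.
have : 0 <= #|k|%:R * q ^+ 2 by rewrite mulr_ge0 ?sqr_ge0 ?ler0n.
move: key; rewrite -[2 * _ * _]mulrA.
move: (#|X|%:R * _) (#|k|%:R * _) (8 * b ^+ 3 * q * q ^+ 2) => u v w; lra.
Qed.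

(** [|U + y * U|] equals [|U|] at [y = 0], below both windows by the size hypotheses, and at the
    expander it is at least half of the smaller of [|U|^2] and [|k| - 1]. Which of these is smaller
    decides which window is crossed. *)
Lemma card_generators_le :
    1 <= kappa -> 4 * b ^+ 2 <= #|U|%:R -> #|U|%:R * (8 * b ^+ 2) <= #|k|%:R ->
  #|X|%:R <= 32 * kappa ^+ 4 * b ^+ 5.
Proof.
move=> kappa_ge1 u_ge u_le.
have b_gt0 : 0 < b by apply: lt_le_trans b_ge1.
have b2_ge1 : 1 <= b ^+ 2 by apply: exprn_ege1.
have step x y : x \in X -> y \in genfield X -> g (x * y) <= b * g y /\ g (y + x) <= b * g y.
  by move=> xX _; split; [apply: card_sumset_stepM|apply: card_sumset_stepD].
have u_ge4 : 4 <= #|U|%:R :> R by apply: le_trans u_ge; lra.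
have k_ge : 32 <= #|k|%:R :> R by apply: le_trans u_le; nra.
have k_gt1 : (1 < #|k|)%N by rewrite -(ltr_nat R); lra.
have [y yk yg] := exists_expander k_gt1.
have gy_ge : 4 <= g y.
  by apply: le_trans u_ge4 _; rewrite ler_nat card_sumset_ge ?dilate_neq0.
have gy_gt0 : 0 < g y by lra.
have u2_gt0 : 0 < #|U|%:R ^+ 2 :> R by rewrite exprn_gt0 ?card_U_gt0.
have /orP[uk|ku] := le_total (#|U|%:R ^+ 2) (#|k|%:R - 1 : R).
  have [||z zk zg] := genfield_crossing step (c := #|U|%:R ^+ 2 / (4 * b ^+ 2)).
  - rewrite card_sumset_dilate0 ler_pdivlMr; last by lra.
    by rewrite expr2 ler_pM2l ?card_U_gt0.
  - exists y => //; rewrite ltr_pdivrMr; last by lra.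
    have m_gt0 : 0 < #|k|%:R - 1 :> R by lra.
    have : #|U|%:R ^+ 2 <= g y * 2.
      rewrite -(ler_pM2l m_gt0) [leRHS]mulrCA; apply: le_trans yg _.
      by apply: ler_wpM2l; [apply: ltW|lra].
    by nra.
  exact: card_le_of_intersection zg.
have [||z zk zg] := genfield_crossing step (c := #|k|%:R / (8 * b ^+ 2)).
- by rewrite card_sumset_dilate0 ler_pdivlMr //; lra.
- exists y => //; rewrite ltr_pdivrMr; last by lra.
  have : #|k|%:R - 1 <= g y * 2.
    rewrite -(ler_pM2r u2_gt0) -mulrA; apply: le_trans yg _.
    by apply: ler_wpM2l; [apply: ltW|lra].
  by nra.
apply: le_trans (card_le_of_sumset zk zg) _.
apply: ler_wpM2r; first by apply/exprn_ge0/ltW.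
by have : 1 <= kappa ^+ 4 by [apply: exprn_ege1]; lra.
Qed.

End SubsetOfGeneratedField.

(** * Slices of a set by lines over the generated subfield *)

Lemma card_setIn_sum (T : finType) (A : {set T}) (P : pred T) :
  #|[set x in A | P x]| = (\sum_(x in A) P x)%N.
Proof.
rewrite -sum1_card big_mkcond [RHS]big_mkcond /=; apply: eq_bigr => x _.
by rewrite inE; case: (x \in A); case: (P x).
Qed.

Lemma double_count (T T' : finType) (A : {set T}) (B : {set T'}) (P : T -> T' -> bool) :
  (\sum_(x in A) #|[set y in B | P x y]| = \sum_(y in B) #|[set x in A | P x y]|)%N.
Proof.
under eq_bigr do rewrite card_setIn_sum.
by rewrite exchange_big /=; apply: eq_bigr => y _; rewrite card_setIn_sum.
Qed.

Section Lines.
Variable F : finFieldType.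
Implicit Types (k A B X Z : {set F}) (c v w x y : F).

(** The slice is recorded by its coefficients, so that it is a subset of [k] itself. *)
Definition line k B w v : {set F} := [set c in k | w + c * v \in B].

Lemma mem_line k B w v c : (c \in line k B w v) = (c \in k) && (w + c * v \in B).
Proof. by rewrite inE. Qed.

(** For fixed [t], the solutions of [w + c * v - y = t] with [y] in [B] have their [c] in the slice
    of [B] through [w - t]. So if [Z - B] is not much larger than [B], no slice of [Z] is much
    longer than the longest parallel slice of [B]. *)
Lemma card_line_le k B Z m w v : (forall w, #|line k B w v| <= m)%N ->
  (#|line k Z w v| * #|B| <= #|diffset Z B| * m)%N.
Proof.
move=> mP; rewrite -cardsX.
apply: (@card_le_fibers _ _ (fun p => w + p.1 * v - p.2)) => [[c y]|t].
  by case/setXP; rewrite inE => /andP[_ cZ] yB; rewrite mem_diffset.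
apply: leq_trans (mP (w - t)); rewrite -(@card_in_imset _ _ (fun p => p.1)).
  apply/subset_leq_card/subsetP=> _ /imsetP[[c y] cyP ->]; move: cyP.
  rewrite inE => /andP[/setXP[]].
  rewrite inE => /andP[ck cZ] yB /eqP tE /=; rewrite inE ck -tE /=.
  by have -> : w - (w + c * v - y) + c * v = y by ring.
move=> [c y] [c' y']; rewrite !inE => /andP[_ /eqP /= e1] /andP[_ /eqP /= e2] cc.
have -> : y = w + c * v - t by rewrite -e1; ring.
have -> : y' = w + c' * v - t by rewrite -e2; ring.
by rewrite cc.
Qed.

Lemma diffset_diffset A B C : diffset (diffset A B) C = diffset A (sumset B C).
Proof. by rewrite !diffsetE dilate_sumset sumsetA. Qed.

Lemma card_sumset_bigcup A X (Y : F -> {set F}) :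
  (forall z, z \in A -> exists2 x, x \in X & z \in Y x) ->
  (#|A| <= \sum_(x in X) #|Y x|)%N.
Proof.
move=> cov; pose D := [set p : F * F | (p.1 \in X) && (p.2 \in Y p.1)].
have -> : (\sum_(x in X) #|Y x| = #|D|)%N.
  rewrite (@card_fibers _ _ (fun p => p.1) D X); last by move=> p; rewrite inE => /andP[].
  apply: eq_bigr => x xX; have inj : injective (fun y : F => (x, y)) by move=> ? ? [].
  rewrite -(card_imset _ inj); apply: eq_card => -[x' y]; rewrite !inE /=.
  apply/imsetP/andP => [[y' yY [-> ->]]|[/andP[x'X yY] /eqP xx]]; first by rewrite xX yY.
  by exists y; rewrite -?xx.
apply: leq_trans (leq_imset_card (fun p => p.2) D).
apply/subset_leq_card/subsetP=> z /cov[x xX zY]; apply/imsetP.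
by exists (x, z); rewrite ?inE ?xX.
Qed.

End Lines.

(** * A structured subset from bounded growth *)

Section StructuredSubset.
Variables (R : realFieldType) (F : finFieldType) (X B : {set F}) (b kappa : R).
Hypotheses (X0 : 0 \notin X) (B0 : B != set0) (b_ge1 : 1 <= b) (kappa_ge1 : 1 <= kappa).
Hypothesis growth : forall x, x \in X ->
  #|diffset (sumset B (dilate x B)) (sumset B B)|%:R <= b * #|B|%:R.
Hypothesis doubling : #|diffset (sumset B B) (sumset B B)|%:R <= kappa * #|B|%:R.

Let k := genfield X.
Let n : R := #|B|%:R.
Let n_gt0 : 0 < n. Proof. by rewrite ltr0n card_gt0. Qed.
Let b_gt0 : 0 < b. Proof. exact: lt_le_trans b_ge1. Qed.

Lemma sumset_neq0 (A C : {set F}) : A != set0 -> C != set0 -> sumset A C != set0.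
Proof.
case/set0Pn=> a aA /set0Pn[c cC]; apply/set0Pn; exists (a + c); exact: mem_sumset.
Qed.

Lemma card_sum_dilate x : x \in X -> #|sumset B (dilate x B)|%:R <= b * n.
Proof.
move=> xX; apply: le_trans (growth xX); rewrite ler_nat card_diffset_ge //.
exact: sumset_neq0.
Qed.

(** The sumset is covered by translates of the [|X|] sets [B + x * B], and here [|X|] is an
    affordable factor. *)
Lemma structured_subset_small : #|X|%:R <= 128 * kappa ^+ 4 * b ^+ 5 ->
  exists2 abar, abar \in B & exists A1 : {set F},
    [/\ A1 \subset Defs.shift B abar, n <= 2 * b * #|A1|%:R &
        #|sumset A1 (prodset X A1)|%:R <= 256 * kappa ^+ 4 * b ^+ 6 * #|A1|%:R].
Proof.
move=> X_le; case/set0Pn: B0 => a aB; exists a => //; exists (Defs.shift B a).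
have sB : #|Defs.shift B a| = #|B| by apply: card_imset; apply: addIr.
rewrite sB -/n; split=> //; first by apply: ler_peMl; [exact: ltW|have := b_ge1; lra].
apply: le_trans (_ : \sum_(x in X) #|sumset B (dilate x B)|%:R <= _).
  rewrite -natr_sum ler_nat.
  apply: leq_trans (_ : (\sum_(x in X) #|[set (z - (a + x * a))%R | z in sumset B (dilate x B)]| <= _)%N).
    apply: card_sumset_bigcup => _ /imset2P[_ _ /imsetP[u uB ->] /imset2P[x _ xX /imsetP[v vB ->] ->] ->].
    exists x => //; apply/imsetP; exists (u + x * v); rewrite ?mem_sumset ?mem_dilate //; ring.
  by apply: leq_sum => x _; apply: leq_imset_card.
apply: le_trans (_ : \sum_(x in X) b * n <= _).
  by apply: ler_sum => x xX; apply: card_sum_dilate.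
rewrite sumr_const -[leLHS]mulr_natl.
have bn : 0 < b * n by rewrite mulr_gt0.
apply: le_trans (ler_wpM2r (ltW bn) X_le) _.
have : 0 < kappa ^+ 4 * b ^+ 6 * n.
  by rewrite !mulr_gt0 ?exprn_gt0 //; apply: lt_le_trans kappa_ge1.
have -> : 128 * kappa ^+ 4 * b ^+ 5 * (b * n) = 128 * (kappa ^+ 4 * b ^+ 6 * n) by ring.
have -> : 256 * kappa ^+ 4 * b ^+ 6 * n = 256 * (kappa ^+ 4 * b ^+ 6 * n) by ring.
by move: (kappa ^+ 4 * _ * _) => z; lra.
Qed.

Section ManyDilates.
Hypothesis X_large : 128 * kappa ^+ 4 * b ^+ 5 < #|X|%:R.

Definition maxline v := (\max_w #|line k B w v|)%N.

Lemma maxlineP v w : (#|line k B w v| <= maxline v)%N.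
Proof. exact: leq_bigmax. Qed.

Lemma maxline_witness v : exists w, #|line k B w v| = maxline v.
Proof.
have F_gt0 : (0 < #|F|)%N by apply/card_gt0P; exists 0.
by rewrite /maxline; have [w ->] := bigop.eq_bigmax (fun w => #|line k B w v|) F_gt0; exists w.
Qed.

Lemma card_line_ratio (Z : {set F}) (c : R) w v :
    #|diffset Z B|%:R <= c * n -> #|line k Z w v|%:R <= c * (maxline v)%:R.
Proof.
move=> Zc; rewrite -(ler_pM2r n_gt0).
have := card_line_le Z w (maxlineP v); rewrite -(ler_nat R) !natrM => /le_trans; apply.
by rewrite mulrAC ler_wpM2r ?ler0n.
Qed.

(** The longest slice [U] of [B] in direction [v] inherits the growth bounds: [U + x * U - U] lies
    in a slice of [B + x * B - B]. Comparing this slice with [U] costs one more subtraction of [B],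
    hence the form of [growth] and [doubling]. A [U] of intermediate size would then contradict
    [X_large]. *)
Lemma line_dichotomy v :
  (maxline v)%:R < 4 * b ^+ 2 \/ #|k|%:R < (maxline v)%:R * (8 * b ^+ 2).
Proof.
have [w wE] := maxline_witness v; set U := line k B w v in wE.
have Uk : U \subset k by apply/subsetP=> c; rewrite inE => /andP[].
have U0 : U != set0.
  case/set0Pn: B0 => a aB; rewrite -card_gt0 wE; apply: leq_trans (maxlineP v a).
  by apply/card_gt0P; exists 0; rewrite mem_line genfield0 mul0r addr0.
have growU x : x \in X -> #|diffset (sumset U (dilate x U)) U|%:R <= b * #|U|%:R.
  move=> xX; have xk := subsetP (genfield_sub X) x xX.
  rewrite wE; apply: le_trans (card_line_ratio (Z := diffset (sumset B (dilate x B)) B)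
    (w + x * w - w) v _); last by rewrite diffset_diffset growth.
  rewrite ler_nat; apply/subset_leq_card/subsetP=> z.
  case/imset2P=> u c /imset2P[d u' dU /imsetP[e eU ->] ->] cU ->; move: dU eU cU.
  rewrite !mem_line => /andP[dk dB] /andP[ek eB] /andP[ck cB].
  rewrite genfieldB ?genfieldD ?genfieldM //=.
  have -> : w + x * w - w + (d + x * e - c) * v =
    (w + d * v) + x * (w + e * v) - (w + c * v) by ring.
  by rewrite mem_diffset ?mem_sumset ?mem_dilate.
have doubU : #|diffset (sumset U U) U|%:R <= kappa * #|U|%:R.
  rewrite wE; apply: le_trans (card_line_ratio (Z := diffset (sumset B B) B)
    (w + w - w) v _); last by rewrite diffset_diffset.
  rewrite ler_nat; apply/subset_leq_card/subsetP=> z.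
  case/imset2P=> u c /imset2P[d e dU eU ->] cU ->; move: dU eU cU.
  rewrite !mem_line => /andP[dk dB] /andP[ek eB] /andP[ck cB].
  rewrite genfieldB ?genfieldD //=.
  have -> : w + w - w + (d + e - c) * v = (w + d * v) + (w + e * v) - (w + c * v) by ring.
  by rewrite mem_diffset ?mem_sumset.
have [ge1|lt1] := boolP (4 * b ^+ 2 <= (maxline v)%:R); [right|by left; rewrite ltNge].
rewrite ltNge; apply/negP => ge2; move: X_large; apply/negP; rewrite -leNgt.
rewrite -wE in ge1 ge2.
apply: le_trans (card_generators_le X0 b_ge1 U0 Uk growU doubU kappa_ge1 ge1 ge2) _.
have : 0 < kappa ^+ 4 * b ^+ 5.
  by rewrite mulr_gt0 ?exprn_gt0 //; apply: lt_le_trans kappa_ge1.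
rewrite -2!mulrA; move: (kappa ^+ 4 * _) => z; lra.
Qed.

Let rich v := #|k|%:R < (maxline v)%:R * (8 * b ^+ 2).

(** These [x] are coefficients of the slice of [B - B] through [0], which is at most [kappa] times
    as long as the longest slice of [B] in direction [v]. *)
Lemma poor_multipliers v : ~~ rich v ->
  #|[set x in X | x * v \in diffset B B]|%:R <= 4 * kappa * b ^+ 2.
Proof.
move=> poor; have {poor} poor : (maxline v)%:R < 4 * b ^+ 2.
  by case: (line_dichotomy v) => // r; move: poor; rewrite /rich r.
have -> : 4 * kappa * b ^+ 2 = kappa * (4 * b ^+ 2) by ring.
apply: le_trans (_ : kappa * (maxline v)%:R <= _); last first.
  by apply: ler_wpM2l; [apply: le_trans kappa_ge1|apply: ltW].
apply: le_trans (card_line_ratio (Z := diffset B B) 0 v _).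
  rewrite ler_nat; apply/subset_leq_card/subsetP=> x; rewrite inE mem_line => /andP[xX xvB].
  by rewrite add0r xvB (subsetP (genfield_sub X)).
apply: le_trans doubling; rewrite diffset_diffset.
rewrite [leLHS](_ : _ = #|diffset (sumset B B) B|%:R); last by rewrite card_diffsetC.
by rewrite ler_nat -diffset_diffset card_diffset_ge.
Qed.

(** Smallness of [B + x * B] makes the energy large, and a pair [(a3, a4)] has at most [|B|]
    completions because [a2] determines [a1]. *)
Lemma card_difference_pairs x : x \in X ->
  n ^+ 2 <= b * #|[set p in setX B B | x * (p.1 - p.2) \in diffset B B]|%:R.
Proof.
move=> xX; set D := [set p in _ | _].
have E : (energy B x <= #|D| * #|B|)%N.
  pose f (t : F * F * F * F) := let: (a1, a2, a3, a4) := t in ((a3, a4), a2).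
  rewrite -cardsX /energy -(@card_in_imset _ _ f).
    apply/subset_leq_card/subsetP=> _ /imsetP[[[[a1 a2] a3] a4] tP ->]; move: tP.
    rewrite inE => /and5P[a1B a2B a3B a4B /eqP e].
    by rewrite in_setX a2B andbT inE in_setX a3B a4B /= -e mem_diffset.
  move=> [[[a1 a2] a3] a4] [[[c1 c2] c3] c4]; rewrite !inE.
  case/and5P=> _ _ _ _ /eqP ea /and5P[_ _ _ _ /eqP ec] [e3 e4 e2].
  rewrite e2 e3 e4 in ea *.
  by have -> : a1 = c1 by apply: (addIr (- c2)); rewrite ea ec.
have n2_gt0 : 0 < n ^+ 2 by rewrite exprn_gt0.
rewrite -(ler_pM2r n2_gt0) -exprD; apply: le_trans (energy_ge R B x) _.
apply: le_trans (_ : (#|D| * #|B|)%:R * (b * n) <= _).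
  by apply: ler_pM; rewrite ?ler0n ?ler_nat ?card_sum_dilate.
by rewrite natrM le_eqVlt; apply/orP; left; apply/eqP; rewrite /n; ring.
Qed.

Let RP := [set p in setX B B | rich (p.1 - p.2)].

(** Double counting of the [(x, p)] with [x * (p.1 - p.2)] in [B - B]. A poor pair occurs with at
    most [4 * kappa * b^2] elements [x], and [8 * kappa * b^3 <= |X|], so the poor pairs supply at
    most half of the count. *)
Lemma card_rich_pairs : n ^+ 2 <= 2 * b * #|RP|%:R.
Proof.
have H1 : #|X|%:R * n ^+ 2 <=
    b * (\sum_(p in setX B B) #|[set x in X | (x * (p.1 - p.2))%R \in diffset B B]|)%:R.
  rewrite -double_count natr_sum mulr_sumr mulr_natl -sumr_const.
  by apply: ler_sum => x xX; apply: card_difference_pairs.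
have H2 : (\sum_(p in setX B B) #|[set x in X | (x * (p.1 - p.2))%R \in diffset B B]|)%:R
    <= #|RP|%:R * #|X|%:R + n ^+ 2 * (4 * kappa * b ^+ 2).
  rewrite natr_sum (bigID (fun p => rich (p.1 - p.2))) /=; apply: lerD.
    rewrite mulr_natl -sumr_const [leRHS](eq_bigl _ _ (fun p => in_set _ _)) /=.
    apply: ler_sum => p _; rewrite ler_nat; apply: subset_leq_card.
    by apply/subsetP=> x; rewrite inE => /andP[].
  apply: le_trans (_ : \sum_(p in setX B B) (4 * kappa * b ^+ 2) <= _); last first.
    by rewrite sumr_const cardsX -[leLHS]mulr_natl natrM expr2.
  rewrite [leRHS](bigID (fun p => rich (p.1 - p.2))) /=.
  rewrite -[leLHS]add0r; apply: lerD.
    apply: sumr_ge0 => p _; apply: mulr_ge0; last by apply/exprn_ge0/ltW.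
    by have := kappa_ge1; lra.
  by apply: ler_sum => p /andP[_]; apply: poor_multipliers.
have X_gt0 : 0 < #|X|%:R :> R.
  apply: le_lt_trans X_large; rewrite mulr_ge0 ?exprn_ge0 ?(ltW b_gt0) //.
  by rewrite mulr_ge0 // exprn_even_ge0.
have b2 : 1 <= b ^+ 2 by apply: exprn_ege1.
have k3 : 1 <= kappa ^+ 3 by apply: exprn_ege1.
have X_ge : 8 * kappa * b ^+ 3 <= #|X|%:R.
  apply: le_trans (ltW X_large).
  have -> : 128 * kappa ^+ 4 * b ^+ 5 = (kappa * b ^+ 3) * (128 * (kappa ^+ 3 * b ^+ 2)) by ring.
  have -> : 8 * kappa * b ^+ 3 = (kappa * b ^+ 3) * 8 by ring.
  apply: ler_wpM2l; first by rewrite mulr_ge0 ?exprn_ge0 ?(ltW b_gt0) //; apply: le_trans kappa_ge1.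
  have : 1 <= kappa ^+ 3 * b ^+ 2 by rewrite -[1]mulr1 ler_pM.
  lra.
have H3 := le_trans H1 (ler_wpM2l (ltW b_gt0) H2).
have H4 : n ^+ 2 * (8 * kappa * b ^+ 3) <= n ^+ 2 * #|X|%:R.
  by apply: ler_wpM2l; rewrite ?sqr_ge0.
rewrite -(ler_pM2r X_gt0).
have e1 : b * (#|RP|%:R * #|X|%:R + n ^+ 2 * (4 * kappa * b ^+ 2)) =
   (2 * b * #|RP|%:R * #|X|%:R + n ^+ 2 * (8 * kappa * b ^+ 3)) / 2 by field.
rewrite e1 in H3; move: H3 H4.
rewrite [#|X|%:R * _]mulrC.
move: (2 * b * #|RP|%:R * #|X|%:R) (n ^+ 2 * #|X|%:R) (n ^+ 2 * _) => u v w; lra.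
Qed.

(** On a fiber of [x * c - d] over [U' * U], increments satisfy [d - d0 = x * (c - c0)]. Hence
    [(c - c0) * (a' + x * a)] is a difference of [B] in direction [a'] plus one in direction [a].
    Each slice fills at least [1 / (8 * b^2)] of [k], whence [64 * b^4]. *)
Lemma card_rich_multiples a a' x : rich a -> rich a' -> x \in X ->
  #|k|%:R <= 64 * b ^+ 4 *
    #|[set c in k | c * (a' + x * a) \in diffset (sumset B B) (sumset B B)]|%:R.
Proof.
move=> ra ra' xX; set C := [set c in k | _].
have xk := subsetP (genfield_sub X) x xX.
have [w wE] := maxline_witness a; have [w' wE'] := maxline_witness a'.
set U := line k B w a in wE; set U' := line k B w' a' in wE'.
have k_gt0 : 0 < #|k|%:R :> R.
  by rewrite ltr0n; apply/card_gt0P; exists 0; apply: genfield0.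
have lineP v u c : c \in line k B u v -> c \in k /\ u + c * v \in B.
  by rewrite inE => /andP[].
pose f (p : F * F) := x * p.1 - p.2.
have fk : {in setX U' U, forall p, f p \in k}.
  move=> [c d] /setXP[/lineP[ck _] /lineP[dk _]].
  by rewrite /f genfieldB ?genfieldM.
have prod_ge : #|k|%:R ^+ 2 <= #|setX U' U|%:R * (64 * b ^+ 4) :> R.
  rewrite cardsX natrM wE wE'.
  have -> : (maxline a')%:R * (maxline a)%:R * (64 * b ^+ 4) =
    ((maxline a')%:R * (8 * b ^+ 2)) * ((maxline a)%:R * (8 * b ^+ 2)) :> R by ring.
  by rewrite expr2; apply: ler_pM; rewrite ?ltW.
have UU0 : setX U' U != set0.
  rewrite -card_gt0 -(ltr0n R).
  have : 0 < #|setX U' U|%:R * (64 * b ^+ 4).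
    by apply: lt_le_trans prod_ge; rewrite exprn_gt0.
  by rewrite pmulr_lgt0 // mulr_gt0 ?exprn_gt0.
have [t tk] := large_fiber UU0 fk; set V := [set p in _ | _] => cV.
have VC : (#|V| <= #|C|)%N.
  have [->|/set0Pn[p0 p0V]] := eqVneq V set0; first by rewrite cards0.
  have VP p : p \in V -> [/\ p.1 \in U', p.2 \in U & x * p.1 - p.2 = t].
    by case: p => p1 p2; rewrite inE => /andP[/setXP[p1U p2U] /eqP].
  have [/lineP[q1k q1] /lineP[q2k q2] qt] := VP _ p0V.
  rewrite -(@card_in_imset _ _ (fun p => p.1 - p0.1)).
    apply/subset_leq_card/subsetP=> _ /imsetP[p pV ->].
    have [/lineP[p1k p1] /lineP[p2k p2] pt] := VP _ pV.
    rewrite inE genfieldB //=.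
    have -> : (p.1 - p0.1) * (a' + x * a) =
        ((w' + p.1 * a') + (w + p.2 * a)) - ((w' + p0.1 * a') + (w + p0.2 * a)).
      have -> : p.2 = x * p.1 - t by rewrite -pt; ring.
      have -> : p0.2 = x * p0.1 - t by rewrite -qt; ring.
      ring.
    by rewrite mem_diffset ?mem_sumset.
  move=> [p1 p2] [q1' q2'] /VP[_ _ /= pt] /VP[_ _ /= qt'] /addIr /= e.
  by move: pt qt'; rewrite e => <- /addrI/oppr_inj ->.
rewrite -(ler_pM2l k_gt0) -expr2; apply: le_trans prod_ge _.
have -> : #|k|%:R * (64 * b ^+ 4 * #|C|%:R) = (#|k|%:R * #|C|%:R) * (64 * b ^+ 4) by ring.
apply: ler_wpM2r; first by rewrite mulr_ge0 ?exprn_even_ge0.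
rewrite -natrM ler_nat; apply: leq_trans cV _.
by rewrite leq_mul2l VC orbT.
Qed.

(** [A1] consists of the rich differences [p - a] for a popular [a]. Every [z] in [A1 + X * A1] has
    a positive proportion of its multiples in [Z], while each nonzero [c] sends at most [|Z|]
    elements into [Z]; counting the pairs [(c, z)] loses nothing that depends on [|X|]. *)
Lemma structured_subset_large :
  exists2 abar, abar \in B & exists A1 : {set F},
    [/\ A1 \subset Defs.shift B abar, n <= 2 * b * #|A1|%:R &
        #|sumset A1 (prodset X A1)|%:R <= 256 * kappa * b ^+ 5 * #|A1|%:R].
Proof.
have RP0 : RP != set0.
  rewrite -card_gt0 -(ltr0n R).
  have : 0 < 2 * b * #|RP|%:R by apply: lt_le_trans card_rich_pairs; rewrite exprn_gt0.
  by rewrite pmulr_rgt0 // mulr_gt0.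
have f2 : {in RP, forall p, p.2 \in B}.
  by move=> [p1 p2]; rewrite inE => /andP[/setXP[]].
have [a aB] := large_fiber RP0 f2; set V := [set p in _ | _] => cV.
exists a => //; exists [set p.1 - p.2 | p in V].
have VP p : p \in V -> [/\ p.1 \in B, p.2 = a & rich (p.1 - p.2)].
  case: p => p1 p2; rewrite inE => /andP[]; rewrite inE => /andP[/setXP[p1B p2B] r].
  by move=> /eqP /=.
set A1 := [set _ | _ in _].
have cA1 : #|A1| = #|V|.
  apply: card_in_imset => -[p1 p2] [q1 q2] /VP[_ /= -> _] /VP[_ /= -> _].
  by move/addIr ->.
have A1rich v : v \in A1 -> rich v by case/imsetP=> p /VP[_ _ r] ->.
have n_le : n <= 2 * b * #|A1|%:R.
  rewrite -(ler_pM2l n_gt0) -expr2; apply: le_trans card_rich_pairs _.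
  have -> : n * (2 * b * #|A1|%:R) = 2 * b * (n * #|A1|%:R) by ring.
  apply: ler_wpM2l; first by rewrite mulr_ge0 ?ltW.
  by rewrite cA1 -natrM ler_nat.
split=> //.
  apply/subsetP=> _ /imsetP[p /VP[pB -> _] ->]; apply/imsetP; by exists p.1.
set S := sumset _ _; pose Z := diffset (sumset B B) (sumset B B).
pose k' := k :\ 0.
have b4 : 0 < b ^+ 4 by rewrite exprn_gt0.
have k_large : 128 * b ^+ 4 <= #|k|%:R.
  apply: le_trans (_ : #|X|%:R <= _); last first.
    by rewrite ler_nat subset_leq_card ?genfield_sub.
  apply: le_trans (ltW X_large).
  have -> : 128 * kappa ^+ 4 * b ^+ 5 = (128 * b ^+ 4) * (kappa ^+ 4 * b) by ring.
  apply: ler_peMr; first by rewrite mulr_ge0 ?ltW.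
  by rewrite -[1]mulr1 ler_pM ?exprn_ege1.
have k_gt0 : 0 < #|k|%:R :> R by apply: lt_le_trans k_large; rewrite mulr_gt0.
have SP z : z \in S -> #|k|%:R <= 128 * b ^+ 4 * #|[set c in k' | c * z \in Z]|%:R.
  case/imset2P=> a' _ a'A /imset2P[x v xX vA ->] ->.
  have := card_rich_multiples (A1rich _ vA) (A1rich _ a'A) xX.
  set C := [set c in k | _]; set C' := [set c in k' | _] => H.
  (* The multiple by [c = 0] carries no information and is discarded; [k_large] pays for it by
     turning 64 into 128. *)
  have CC' : (#|C| <= #|C'| + 1)%N.
    rewrite (cardsD1 0 C) addnC; apply: leq_add; last by case: (_ \in _).
    apply/subset_leq_card/subsetP=> c /setD1P[c0].
    by rewrite inE => /andP[ck cZ]; rewrite inE in_setD1 c0 ck.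
  have {CC'} CC' : #|C|%:R <= #|C'|%:R + 1 :> R by rewrite natr1 ler_nat -addn1.
  have := ler_wpM2l (ltW b4) CC'; move: H k_large.
  move: (b ^+ 4) #|k|%:R #|C|%:R #|C'|%:R => u v1 v2 v3; nra.
have up : (\sum_(z in S) #|[set c in k' | (c * z)%R \in Z]| <= #|k| * #|Z|)%N.
  rewrite double_count; apply: leq_trans (_ : (\sum_(c in k') #|Z| <= _)%N).
    apply: leq_sum => c /setD1P[c0 _].
    rewrite -(card_dilate _ c0); apply: subset_leq_card; apply/subsetP=> _ /imsetP[z + ->].
    by rewrite inE => /andP[].
  by rewrite sum_nat_const leq_mul2r subset_leq_card ?orbT // subD1set.
have SZ : #|S|%:R <= 128 * b ^+ 4 * #|Z|%:R.
  rewrite -(ler_pM2r k_gt0).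
  have -> : 128 * b ^+ 4 * #|Z|%:R * #|k|%:R = 128 * b ^+ 4 * (#|k|%:R * #|Z|%:R) by ring.
  have b4' : 0 <= 128 * b ^+ 4 by rewrite mulr_ge0 ?ltW.
  rewrite -natrM; move: up; rewrite -(ler_nat R) => up.
  apply: le_trans (ler_wpM2l b4' up).
  rewrite natr_sum mulr_sumr [leLHS]mulr_natl -sumr_const; apply: ler_sum => z; exact: SP.
apply: le_trans SZ _.
have H1 : #|Z|%:R <= kappa * (2 * b * #|A1|%:R).
  by apply: le_trans doubling _; apply: ler_wpM2l => //; apply: le_trans kappa_ge1.
apply: le_trans (ler_wpM2l (_ : 0 <= 128 * b ^+ 4) H1) _.
  by rewrite mulr_ge0 ?ltW.
by rewrite le_eqVlt; apply/orP; left; apply/eqP; ring.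
Qed.

End ManyDilates.

Lemma structured_subset :
  exists2 abar, abar \in B & exists A1 : {set F},
    [/\ A1 \subset Defs.shift B abar, n <= 2 * b * #|A1|%:R &
        #|sumset A1 (prodset X A1)|%:R <= 256 * kappa ^+ 4 * b ^+ 6 * #|A1|%:R].
Proof.
have [/structured_subset_small //|] := boolP (#|X|%:R <= 128 * kappa ^+ 4 * b ^+ 5).
rewrite -ltNge => X_large.
have [a aB [A1 [sA nA cA]]] := structured_subset_large X_large.
exists a => //; exists A1; split=> //; apply: le_trans cA _.
apply: ler_wpM2r => //.
have -> : 256 * kappa ^+ 4 * b ^+ 6 = (256 * kappa * b ^+ 5) * (kappa ^+ 3 * b) by ring.
have k_ge0 : 0 <= kappa by apply: le_trans kappa_ge1.
apply: ler_peMr; first by rewrite !mulr_ge0 ?exprn_ge0 ?(ltW b_gt0).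
by rewrite -[1]mulr1 ler_pM ?exprn_ege1.
Qed.

End StructuredSubset.

(** * The Balog-Szemeredi-Gowers theorem *)

Section BalogSzemerediGowers.
Variables (R : realFieldType) (T : finType) (A : {set T}) (G : {set T * T}) (gamma : R).
Hypotheses (A0 : A != set0) (gamma_gt0 : 0 < gamma).
Hypothesis G_large : gamma * #|A|%:R ^+ 2 <= #|G|%:R.
Hypothesis GA : G \subset setX A A.

Let n : R := #|A|%:R.
Let n_gt0 : 0 < n. Proof. by rewrite ltr0n card_gt0. Qed.

Let deg a := #|[set b in A | (a, b) \in G]|.
Let At := [set a in A | gamma * n / 2 <= (deg a)%:R].
Let N b := [set a in At | (a, b) \in G].
Let codeg (p : T * T) := #|[set b in A | ((p.1, b) \in G) && ((p.2, b) \in G)]|.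
Let Bad := [set p in setX At At | (codeg p)%:R < gamma ^+ 3 / 128 * n].

Lemma sum_deg_large : gamma * n ^+ 2 / 2 <= \sum_(b in A) #|N b|%:R.
Proof.
have -> : \sum_(b in A) #|N b|%:R = (\sum_(a in At) deg a)%:R :> R.
  by rewrite -natr_sum double_count.
have E : (#|G| = \sum_(a in A) deg a)%N.
  have GP : {in G, forall p, p.1 \in A} by move=> [a b] /(subsetP GA)/setXP[].
  rewrite (card_fibers GP); apply: eq_bigr => a aA.
  have inj : injective (fun b : T => (a, b)) by move=> ? ? [].
  rewrite /deg -(card_imset _ inj); apply: eq_card => -[a' b]; rewrite inE /=.
  apply/andP/imsetP => [[abG /eqP <-]|[b' + [-> ->]]].
    by exists b; rewrite ?inE ?abG ?andbT //; have /setXP[] := subsetP GA _ abG.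
  by rewrite inE => /andP[].
have : #|G|%:R <= (\sum_(a in At) deg a)%:R + n * (gamma * n / 2) :> R.
  rewrite E (bigID (fun a => gamma * n / 2 <= (deg a)%:R)) natrD /=.
  apply: lerD.
    rewrite ler_nat [leqRHS](eq_bigl (fun a => (a \in A) && (gamma * n / 2 <= (deg a)%:R))) //.
    by move=> a; rewrite inE.
  rewrite natr_sum; apply: le_trans (_ : \sum_(a in A | ~~ (gamma * n / 2 <= (deg a)%:R)) gamma * n / 2 <= _).
    by apply: ler_sum => a /andP[_]; rewrite -ltNge => /ltW.
  rewrite mulr_natl -sumr_const [leRHS](bigID (fun a => gamma * n / 2 <= (deg a)%:R)) /=.
  by rewrite lerDr sumr_ge0 // => a _; rewrite divr_ge0 ?mulr_ge0 ?(ltW gamma_gt0).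
have := G_large; rewrite -/n; lra.
Qed.

(** Averaging over [b]. By Cauchy-Schwarz the mean of [|N b|^2] is at least [gamma^2 * n^2 / 4]. A
    bad pair lies in fewer than [gamma^3 * n / 128] of the sets [N b], so with weight [16 / gamma]
    the penalty has mean at most [gamma^2 * n^2 / 8]. *)
Lemma exists_good_vertex : exists2 b, b \in A &
  gamma ^+ 2 * n ^+ 2 / 8 <= #|N b|%:R ^+ 2
    - 16 / gamma * #|[set p in Bad | (p.1 \in N b) && (p.2 \in N b)]|%:R.
Proof.
pose f b : R := #|N b|%:R ^+ 2
    - 16 / gamma * #|[set p in Bad | (p.1 \in N b) && (p.2 \in N b)]|%:R.
have [b bA fb] : exists2 b, b \in A & (\sum_(i in A) f i) / n <= f b.
  case: (pickP [pred b in A | (\sum_(i in A) f i) / n <= f b]) => [b /andP[bA]|none].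
    by exists b.
  suff : \sum_(b in A) f b < \sum_(b in A) f b by rewrite ltxx.
  have : \sum_(b in A) f b < \sum_(b in A) (\sum_(i in A) f i) / n.
    apply: ltr_sum => [|b bA]; last by have := none b; rewrite /= bA ltNge /= => ->.
    by case/set0Pn: A0 => a aA; apply/hasP; exists a; rewrite ?mem_index_enum.
  by rewrite sumr_const -[X in _ < X]mulr_natr divfK ?gt_eqF.
exists b => //; apply: le_trans fb; rewrite ler_pdivlMr // /f sumrB -mulr_sumr.
have H1 : gamma ^+ 2 * n ^+ 3 / 4 <= \sum_(b in A) #|N b|%:R ^+ 2.
  rewrite -(ler_pM2l n_gt0); apply: le_trans (sum_sqr_ge A (fun b => #|N b|%:R)).
  have -> : n * (gamma ^+ 2 * n ^+ 3 / 4) = (gamma * n ^+ 2 / 2) ^+ 2 by field.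
  have := sum_deg_large; set s := \sum_(b in A) _ => Hs.
  have p0 : 0 <= gamma * n ^+ 2 / 2 by rewrite divr_ge0 ?mulr_ge0 ?sqr_ge0 ?(ltW gamma_gt0).
  by rewrite !expr2; apply: ler_pM.
have H2 : \sum_(b in A) #|[set p in Bad | (p.1 \in N b) && (p.2 \in N b)]|%:R <=
    n ^+ 2 * (gamma ^+ 3 / 128 * n).
  rewrite -natr_sum double_count natr_sum.
  apply: le_trans (_ : \sum_(p in Bad) gamma ^+ 3 / 128 * n <= _).
    apply: ler_sum => p; rewrite inE => /andP[_ /ltW]; apply: le_trans; rewrite ler_nat.
    apply/subset_leq_card/subsetP=> c; rewrite !inE => /andP[cA /andP[/andP[_ p1] /andP[_ p2]]].
    by rewrite cA p1 p2.
  rewrite sumr_const -[leLHS]mulr_natl; apply: ler_wpM2r.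
    by rewrite mulr_ge0 ?divr_ge0 ?exprn_ge0 ?(ltW gamma_gt0).
  rewrite -natrX ler_nat expnS expn1 -cardsX; apply/subset_leq_card/subsetP=> -[a a'].
  by rewrite inE => /andP[/setXP[]]; rewrite !inE => /andP[-> _] /andP[-> _].
have H3 : 16 / gamma * \sum_(b in A) #|[set p in Bad | (p.1 \in N b) && (p.2 \in N b)]|%:R <=
    gamma ^+ 2 * n ^+ 3 / 8.
  apply: le_trans (ler_wpM2l _ H2) _; first by rewrite divr_ge0 ?(ltW gamma_gt0).
  rewrite le_eqVlt; apply/orP; left; apply/eqP; field; by rewrite gt_eqF.
have -> : gamma ^+ 2 * n ^+ 2 / 8 * n = gamma ^+ 2 * n ^+ 3 / 8 by ring.
have e : gamma ^+ 2 * n ^+ 3 / 4 = gamma ^+ 2 * n ^+ 3 / 8 * 2 by field.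
move: H1 H3; rewrite e; move: (gamma ^+ 2 * n ^+ 3 / 8) => u; lra.
Qed.

(** The last bound counts paths [a - b1 - a1 - b], with [p = (a1, b1)]. In the good neighbourhood
    [M] of size [m], [b] has at least [gamma * m / 4] neighbours [a1], of which at most
    [gamma * m / 8] are bad with [a]; each remaining one offers at least [gamma^3 * n / 128] choices
    of [b1]. *)
Lemma balog_szemeredi_gowers : exists A' B' : {set T},
  [/\ A' \subset A, B' \subset A,
      gamma * n / 8 <= #|A'|%:R, gamma * n / 8 <= #|B'|%:R &
   forall a b, a \in A' -> b \in B' -> gamma ^+ 5 * n ^+ 2 / 4096 <=
     #|[set p : T * T | [&& (a, p.2) \in G, (p.1, p.2) \in G & (p.1, b) \in G]]|%:R].
Proof.
have [b0 b0A] := exists_good_vertex; set M := N b0; pose m : R := #|M|%:R.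
set bad : R := (X in _ - _ * X); rewrite -/m => mP.
have bad_ge0 : 0 <= 16 / gamma * bad by rewrite mulr_ge0 ?divr_ge0 ?(ltW gamma_gt0).
(* The fraction 1/3 is a rational lower bound for the square root of 1/8. *)
have m2_ge : (gamma * n / 3) ^+ 2 <= m ^+ 2.
  have -> : (gamma * n / 3) ^+ 2 = gamma ^+ 2 * n ^+ 2 / 8 * (8 / 9) by field.
  have : 0 <= gamma ^+ 2 * n ^+ 2 / 8 by apply: divr_ge0 => //; apply: mulr_ge0; apply: sqr_ge0.
  move: mP bad_ge0; move: (gamma ^+ 2 * n ^+ 2 / 8) (16 / gamma * bad) (m ^+ 2) => u v w; lra.
have gn_gt0 : 0 < gamma * n by rewrite mulr_gt0.
have m_ge : gamma * n / 3 <= m.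
  move: m2_ge; rewrite ler_pXn2r // nnegrE; last exact: ler0n.
  by rewrite divr_ge0 ?(ltW gn_gt0).
have m_gt0 : 0 < m by apply: lt_le_trans m_ge; rewrite divr_gt0.
have bad_le : bad <= gamma / 16 * m ^+ 2.
  have : 16 / gamma * bad <= m ^+ 2.
    have : 0 <= gamma ^+ 2 * n ^+ 2 / 8 by apply: divr_ge0 => //; apply: mulr_ge0; apply: sqr_ge0.
    by move: mP; move: (gamma ^+ 2 * n ^+ 2 / 8) (16 / gamma * bad) (m ^+ 2) => u v w; lra.
  move=> H; have g16 : 0 <= gamma / 16 by rewrite divr_ge0 ?(ltW gamma_gt0).
  have := ler_wpM2l g16 H; apply: le_trans; rewrite le_eqVlt; apply/orP; left; apply/eqP.
  by field; rewrite gt_eqF.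
have MAt : M \subset At by apply/subsetP=> a; rewrite inE => /andP[].
have AtA : At \subset A by apply/subsetP=> a; rewrite inE => /andP[].
have MA := subset_trans MAt AtA.
pose badM a := #|[set a' in M | (a, a') \in Bad]|.
pose A' := [set a in M | (badM a)%:R <= gamma / 8 * m].
pose nb b := #|[set a in M | (a, b) \in G]|.
pose B' := [set b in A | gamma / 4 * m <= (nb b)%:R].
have badE : bad = (\sum_(a in M) badM a)%:R.
  congr (_%:R); rewrite (@card_fibers _ _ (fun p => p.1) _ M); last first.
    by move=> p; rewrite inE => /andP[_ /andP[]].
  apply: eq_bigr => a aM; have inj : injective (fun b : T => (a, b)) by move=> ? ? [].
  rewrite /badM -(card_imset _ inj); apply: eq_card => -[a1 a2].
  apply/idP/imsetP.
    case/setIdP=> /setIdP[aB /andP[_ a2M]] /eqP /= e.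
    by exists a2; rewrite -e //; apply/setIdP.
  by case=> a' + [-> ->]; case/setIdP=> a'M aB; apply/setIdP; split=> //; apply/setIdP; split=> //; apply/andP.
exists A', B'; split.
- by apply: subset_trans MA; apply/subsetP=> a; rewrite inE => /andP[].
- by apply/subsetP=> b; rewrite inE => /andP[].
- have H : #|M :\: A'|%:R * (gamma / 8 * m) <= bad.
    rewrite badE natr_sum mulr_natl -sumr_const.
    apply: le_trans (_ : \sum_(a in M :\: A') (badM a)%:R <= _).
      apply: ler_sum => a /setDP[aM]; rewrite inE aM /= -ltNge; exact: ltW.
    rewrite [leRHS](bigID (mem A')) /= -[leLHS]add0r; apply: lerD; first exact: sumr_ge0.
    by rewrite (eq_bigl (fun a => (a \in M) && (a \notin A'))) // => a; rewrite in_setD andbC.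
  have {H} H : #|M :\: A'|%:R <= m / 2.
    have gm : 0 < gamma / 8 * m by rewrite mulr_gt0 ?divr_gt0.
    rewrite -(ler_pM2r gm); apply: le_trans H (le_trans bad_le _).
    by rewrite le_eqVlt; apply/orP; left; apply/eqP; field.
  have : m = #|A'|%:R + #|M :\: A'|%:R.
    rewrite -natrD cardsD (setIidPr _) ?subnKC ?subset_leq_card //;
    by apply/subsetP=> a; rewrite inE => /andP[].
  move: m_ge H gn_gt0; lra.
- have H1 : m * (gamma * n / 2) <= (\sum_(b in A) nb b)%:R.
    rewrite double_count natr_sum mulr_natl -sumr_const; apply: ler_sum => a aM.
    by have := subsetP MAt a aM; rewrite inE => /andP[].
  have H2 : (\sum_(b in A) nb b)%:R <= #|B'|%:R * m + n * (gamma / 4 * m).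
    rewrite natr_sum (bigID (mem B')) /=; apply: lerD.
      rewrite mulr_natl -sumr_const (eq_bigl (mem B')); last first.
        by move=> b; rewrite andb_idl // inE => /andP[].
      apply: ler_sum => b _; rewrite ler_nat; apply: subset_leq_card.
      by apply/subsetP=> a; rewrite inE => /andP[].
    rewrite mulr_natl -sumr_const [leRHS](bigID (mem B')) /= -[leLHS]add0r; apply: lerD.
      by apply: sumr_ge0 => b _; rewrite mulr_ge0 ?divr_ge0 ?(ltW gamma_gt0) ?(ltW m_gt0).
    by apply: ler_sum => b /andP[bA]; rewrite inE bA /= -ltNge => /ltW.
  have : m * (gamma * n / 4) <= m * #|B'|%:R.
    by move: (le_trans H1 H2); rewrite [m * #|_|%:R]mulrC; lra.
  by rewrite ler_pM2l //; lra.
move=> a b; rewrite inE => /andP[aM aP]; rewrite inE => /andP[bA bP].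
pose good := [set a1 in M | ((a1, b) \in G) && ((a, a1) \notin Bad)].
have good_ge : gamma / 8 * m <= #|good|%:R.
  have : (nb b)%:R <= (#|good| + badM a)%:R :> R.
    rewrite ler_nat; apply: leq_trans (leq_card_setU _ _).
    apply/subset_leq_card/subsetP=> a1; rewrite inE => /andP[a1M a1b].
    by rewrite in_setU; have [aB|aB] := boolP ((a, a1) \in Bad); apply/orP; [right|left];
      apply/setIdP; rewrite ?a1b.
  rewrite natrD; move: aP bP; lra.
pose W := [set p : T * T | [&& (a, p.2) \in G, (p.1, p.2) \in G & (p.1, b) \in G]].
have cW : (\sum_(a1 in good) codeg (a, a1) <= #|W|)%N.
  pose D := [set p in W | p.1 \in good].
  apply: leq_trans (_ : (#|D| <= _)%N); last first.
    by apply/subset_leq_card/subsetP=> p; rewrite inE => /andP[].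
  rewrite (@card_fibers _ _ (fun p => p.1) D good); last first.
    by move=> p; rewrite inE => /andP[].
  apply: leq_sum => a1 a1g; have inj : injective (fun b : T => (a1, b)) by move=> ? ? [].
  rewrite /codeg -(card_imset _ inj); apply/subset_leq_card/subsetP=> p /imsetP[b1 + ->].
  case/setIdP=> b1A /= /andP[ab1 a1b1]; have /setIdP[_ /andP[a1b _]] := a1g.
  have pW : (a1, b1) \in W by rewrite /W in_set /= ab1 a1b1.
  have pD : (a1, b1) \in D by rewrite /D in_set pW.
  by rewrite in_set pD /= eqxx.
have {cW} : (\sum_(a1 in good) codeg (a, a1))%:R <= #|W|%:R :> R by rewrite ler_nat.
apply: le_trans; rewrite natr_sum.
apply: le_trans (_ : \sum_(a1 in good) gamma ^+ 3 / 128 * n <= _); last first.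
  apply: ler_sum => a1 /setIdP[a1M /andP[_ aB]]; rewrite leNgt; apply: contra aB => lt.
  by apply/setIdP; rewrite in_setX !(subsetP MAt).
rewrite sumr_const -[leRHS]mulr_natl.
have g3 : 0 <= gamma ^+ 3 / 128 * n.
  by rewrite mulr_ge0 ?divr_ge0 ?exprn_ge0 ?(ltW gamma_gt0).
apply: le_trans (ler_wpM2r g3 good_ge).
apply: le_trans (_ : gamma / 8 * (gamma * n / 3) * (gamma ^+ 3 / 128 * n) <= _); last first.
  apply: ler_wpM2r => //; apply: ler_wpM2l m_ge.
  by rewrite divr_ge0 ?(ltW gamma_gt0).
have -> : gamma / 8 * (gamma * n / 3) * (gamma ^+ 3 / 128 * n) =
  gamma ^+ 5 * n ^+ 2 / 4096 * (4 / 3) by field.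
have : 0 <= gamma ^+ 5 * n ^+ 2 / 4096.
  apply: divr_ge0; last exact: ler0n.
  by apply: mulr_ge0; [apply/exprn_ge0/ltW|apply: sqr_ge0].
by move: (gamma ^+ 5 * n ^+ 2 / 4096) => u; lra.
Qed.

End BalogSzemerediGowers.

(** Dyadic pigeonholing of the number of representations of a difference. [l] counts the levels up
    to [|A|^2], although [|A|] would do here, so that the same [l] later covers the edge counts of
    [G]. *)
Lemma popular_graph (R : realFieldType) (F : finFieldType) (A : {set F}) (xi : F) (K : R) :
    0 < K -> A != set0 -> #|A|%:R ^+ 3 / K <= (energy A xi)%:R ->
  let l := (trunc_log 2 (#|A| ^ 2)).+1 in
  exists D : {set F}, let G := [set p in setX A A | p.1 - xi * p.2 \in D] in
    #|D|%:R * #|A|%:R ^+ 3 <= 2 * l%:R * K * #|G|%:R ^+ 2 :> R /\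
    #|A|%:R ^+ 2 <= 2 * l%:R * K * #|G|%:R :> R.
Proof.
move=> K_gt0 A0 E_ge l; pose f (p : F * F) := p.1 - xi * p.2.
pose r d := #|[set p in setX A A | f p == d]|.
(* [trunc_log] sends both 0 and 1 to 0; the condition [0 < r d] keeps unrepresented [d] out of the
   lowest level. *)
pose Dl (i : 'I_l) := [set d | (0 < r d)%N & trunc_log 2 (r d) == i].
pose Gl i := [set p in setX A A | f p \in Dl i].
have n_gt0 : (0 < #|A|)%N by rewrite card_gt0.
have r_le d : (r d <= #|A|)%N.
  have inj : {in [set p in setX A A | f p == d] &, injective (fun p => p.2)}.
    move=> [a c] [a' c']; rewrite !inE => /andP[_ /eqP e] /andP[_ /eqP e'] /= cc.
    by move: e e'; rewrite /f /= cc => <- /addIr ->.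
  rewrite /r -(card_in_imset inj); apply/subset_leq_card/subsetP=> _ /imsetP[[a c] + ->].
  by rewrite inE => /andP[/setXP[]].
have GE i : #|Gl i| = (\sum_(d in Dl i) r d)%N.
  rewrite (@card_fibers _ _ f _ (Dl i)); last by move=> p /setIdP[].
  apply: eq_bigr => d dD; apply: eq_card => p; apply/setIdP/setIdP => [[/setIdP[pA _] pd]|[pA pd]].
    by split.
  by split=> //; apply/setIdP; split=> //; rewrite (eqP pd).
have EE : (energy A xi <= \sum_(i < l) \sum_(d in Dl i) r d ^ 2)%N.
  rewrite energy_collisions (card_collisions f).
  rewrite (bigID (fun d => 0 < r d)%N) /= [X in (_ + X <= _)%N]big1 ?addn0; last first.
    by move=> d; rewrite -leqNgt leqn0 /r => /eqP ->.
  have lev d : (trunc_log 2 (r d) < l)%N.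
    rewrite ltnS; apply: leq_trunc_log; apply: leq_trans (r_le d) _.
    by rewrite -[X in (X <= _)%N]expn1 leq_pexp2l.
  rewrite (partition_big (fun d => Ordinal (lev d)) predT) //=.
  apply: leq_sum => i _; apply: eq_leq; apply: eq_bigl => d.
  by rewrite inE -val_eqE.
have [i iE] : exists i : 'I_l, (energy A xi <= l * \sum_(d in Dl i) r d ^ 2)%N.
  case: (@arg_maxnP _ ord0 predT (fun i : 'I_l => \sum_(d in Dl i) r d ^ 2)%N isT) => i _ imax.
  exists i; apply: leq_trans EE _.
  apply: leq_trans (_ : (\sum_(j < l) \sum_(d in Dl i) r d ^ 2 <= _)%N).
    by apply: leq_sum => j _; apply: imax.
  by rewrite sum_nat_const card_ord.
pose h := (2 ^ i)%N.
have h_gt0 : (0 < h)%N by rewrite expn_gt0.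
have rh d : d \in Dl i -> (h <= r d < 2 * h)%N.
  rewrite inE => /andP[r_gt0 /eqP di]; rewrite /h -expnS -di.
  by rewrite trunc_logP // trunc_log_ltn.
have up1 : (\sum_(d in Dl i) r d ^ 2 <= 2 * h * #|Gl i|)%N.
  rewrite GE big_distrr /=; apply: leq_sum => d /rh/andP[_ lt].
  by rewrite expnS expn1 leq_mul2r (ltnW lt) orbT.
have Dh : (#|Dl i| * h <= #|Gl i|)%N.
  by rewrite GE -sum_nat_const; apply: leq_sum => d /rh/andP[].
have G_ge : #|A|%:R ^+ 3 <= 2 * l%:R * K * (h%:R * #|Gl i|%:R) :> R.
  have -> : 2 * l%:R * K * (h%:R * #|Gl i|%:R) = (l * (2 * h * #|Gl i|))%:R * K :> R.
    by rewrite !natrM; ring.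
  rewrite -ler_pdivrMr //; apply: le_trans E_ge _; rewrite ler_nat.
  by apply: leq_trans iE _; rewrite leq_mul2l up1 orbT.
have nR_gt0 : 0 < #|A|%:R :> R by rewrite ltr0n.
exists (Dl i); rewrite -/(Gl i); split.
  have lK : 0 <= 2 * l%:R * K by rewrite !mulr_ge0 // ltW.
  apply: le_trans (ler_wpM2l (ler0n _ _) G_ge) _.
  have -> : #|Dl i|%:R * (2 * l%:R * K * (h%:R * #|Gl i|%:R)) =
     2 * l%:R * K * ((#|Dl i| * h)%:R * #|Gl i|%:R) :> R by rewrite natrM; ring.
  by apply: ler_wpM2l => //; rewrite expr2; apply: ler_wpM2r; rewrite ?ler_nat.
have [D0|/set0Pn[d dD]] := eqVneq (Dl i) set0.
  have G0 : #|Gl i| = 0%N by rewrite GE D0 big_set0.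
  by move: G_ge; rewrite G0 !mulr0 leNgt exprn_gt0.
have hA : (h <= #|A|)%N by have /andP[hr _] := rh d dD; apply: leq_trans hr (r_le d).
rewrite -(ler_pM2r nR_gt0) -exprSr; apply: le_trans G_ge _.
rewrite -[leRHS]mulrA; apply: ler_wpM2l; first by rewrite !mulr_ge0 // ltW.
by rewrite mulrC; apply: ler_wpM2l; rewrite ?ler_nat.
Qed.

(** The edge count is rounded down to a power of 2, so that [s] takes one of [l] values and can be
    made the same for many [xi]. The factor 256 in [w] turns [(4 * K1)^3 * 4096 * gamma * n], which
    comes from counting paths, into exactly [w^3 * s * n]. *)
Lemma popular_subsets (R : realFieldType) (F : finFieldType) (A : {set F}) (xi : F) (K : R) :
    xi != 0 -> 0 < K -> A != set0 -> #|A|%:R ^+ 3 / K <= (energy A xi)%:R ->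
  let l := (trunc_log 2 (#|A| ^ 2)).+1 in
  let w := 256 * l%:R * K in
  exists (j : 'I_l) (A' B' : {set F}), let s := (2 ^ j)%:R / 8 / #|A|%:R ^+ 2 in
    [/\ A' \subset A, B' \subset A, s * #|A|%:R <= #|A'|%:R, s * #|A|%:R <= #|B'|%:R &
        2 <= w * s /\ #|diffset A' (dilate xi B')|%:R <= w ^+ 3 * s * #|A|%:R].
Proof.
move=> xi0 K_gt0 A0 E_ge l w; pose n : R := #|A|%:R.
have n_gt0 : 0 < n by rewrite ltr0n card_gt0.
have [D] := popular_graph K_gt0 A0 E_ge; rewrite -/l; set G := [set p in _ | _] => /= -[D_le G_ge].
pose K1 := 2 * l%:R * K; rewrite -/K1 -/n in D_le G_ge.
have K1_gt0 : 0 < K1 by rewrite !mulr_gt0 // ltr0n.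
have G_gt0 : (0 < #|G|)%N.
  rewrite -(ltr0n R) -(pmulr_rgt0 _ K1_gt0); apply: lt_le_trans G_ge.
  by rewrite exprn_gt0.
have GA : G \subset setX A A by apply/subsetP=> p /setIdP[].
have jl : (trunc_log 2 #|G| < l)%N.
  rewrite ltnS; apply: leq_trunc_log; rewrite expnS expn1 -cardsX.
  exact: subset_leq_card.
pose g := (2 ^ trunc_log 2 #|G|)%N.
have /andP[g_le g_gt] : (g <= #|G| < 2 * g)%N by rewrite /g -expnS trunc_logP // trunc_log_ltn.
pose gamma : R := g%:R / n ^+ 2.
have gamma_gt0 : 0 < gamma by rewrite divr_gt0 ?exprn_gt0 // ltr0n expn_gt0.
have gE : gamma * n ^+ 2 = g%:R by rewrite divfK // gt_eqF ?exprn_gt0.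
have G_large : gamma * #|A|%:R ^+ 2 <= #|G|%:R by rewrite -/n gE ler_nat.
have [A' [B' [A'A B'A cA' cB' paths]]] := balog_szemeredi_gowers A0 gamma_gt0 G_large GA.
rewrite -/n in cA' cB' paths.
have sE : (2 ^ trunc_log 2 #|G|)%:R / 8 / n ^+ 2 = gamma / 8 by rewrite mulrAC.
have sn : gamma / 8 * n = gamma * n / 8 by rewrite mulrAC.
exists (Ordinal jl), A', B'; rewrite /= -/n sE; split; rewrite ?sn //.
have G_le : #|G|%:R <= 2 * (gamma * n ^+ 2) by rewrite gE -natrM ler_nat ltnW.
have wE : w = 128 * K1 by rewrite /w /K1; ring.
split.
  have : n ^+ 2 * 1 <= n ^+ 2 * (2 * K1 * gamma).
    rewrite mulr1; apply: le_trans G_ge (le_trans (ler_wpM2l (ltW K1_gt0) G_le) _).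
    by rewrite le_eqVlt; apply/orP; left; apply/eqP; ring.
  rewrite ler_pM2l ?exprn_gt0 // -/w wE; lra.
have D_le' : #|D|%:R <= 4 * K1 * gamma ^+ 2 * n.
  rewrite -(ler_pM2r (exprn_gt0 3 n_gt0)); apply: le_trans D_le _.
  have -> : 4 * K1 * gamma ^+ 2 * n * n ^+ 3 = K1 * (2 * (gamma * n ^+ 2)) ^+ 2 by ring.
  by apply: ler_wpM2l; rewrite ?(ltW K1_gt0) // !expr2 ler_pM.
set Z := diffset A' _.
(* A path from [a] to [b] writes [a - xi * b] as [(a - xi * b1) - (a1 - xi * b1) + (a1 - xi * b)],
   with all three terms in [D]; these terms determine first the difference and then the path. *)
have count : #|Z|%:R * (gamma ^+ 5 * n ^+ 2 / 4096) <= #|D|%:R ^+ 3.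
  have [rep repP] := imset2_rep (fun a b => a - xi * b) A' B' (0, 0).
  have ZE z : z \in Z -> z \in [set a - xi * b | a in A', b in B'].
    by case/imset2P=> a _ aA' /imsetP[b bB' ->] ->; apply: imset2_f.
  pose V z := [set p : F * F | [&& ((rep z).1, p.2) \in G, (p.1, p.2) \in G & (p.1, (rep z).2) \in G]].
  have VP z : z \in Z -> gamma ^+ 5 * n ^+ 2 / 4096 <= #|V z|%:R.
    by move=> /ZE/repP[r1 r2 _]; apply: paths.
  pose T := [set q : F * (F * F) | (q.1 \in Z) && (q.2 \in V q.1)].
  have cT : (\sum_(z in Z) #|V z| = #|T|)%N.
    rewrite (@card_fibers _ _ (fun q => q.1) T Z); last by move=> q; rewrite inE => /andP[].
    apply: eq_bigr => z zZ; have inj : injective (fun p : F * F => (z, p)) by move=> ? ? [].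
    rewrite -(card_imset _ inj); apply: eq_card => -[z' p]; apply/imsetP/idP.
      by case=> p' p'V [-> ->]; rewrite in_set /= eqxx andbT in_set /= zZ.
    rewrite in_set /= => /andP[+ /eqP e]; rewrite in_set /= => /andP[_ pV].
    by exists p; rewrite -e.
  apply: le_trans (_ : #|T|%:R <= _).
    by rewrite -cT natr_sum mulr_natl -sumr_const; apply: ler_sum => z; apply: VP.
  have -> : #|D|%:R ^+ 3 = #|setX (setX D D) D|%:R :> R by rewrite !cardsX !natrM !exprSr expr0 mul1r.
  rewrite ler_nat.
  pose h (q : F * (F * F)) := (((rep q.1).1 - xi * q.2.2, q.2.1 - xi * q.2.2),
     q.2.1 - xi * (rep q.1).2).
  have hE q : q \in T -> q.1 = (h q).1.1 - (h q).1.2 + (h q).2.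
    rewrite in_set => /andP[/ZE/repP[_ _ e] _]; rewrite -[LHS]e /h /=; ring.
  rewrite -(@card_in_imset _ _ h).
    apply/subset_leq_card/subsetP=> _ /imsetP[[z [a1 b1]] qT ->]; move: qT.
    rewrite in_set /= => /andP[_]; rewrite in_set /= => /and3P[g1 g2 g3].
    by move: g1 g2 g3; rewrite !in_setX /= => /setIdP[_ /= ->] /setIdP[_ /= ->] /setIdP[_ /= ->].
  move=> q q' qT q'T e; have e1 : q.1 = q'.1 by rewrite !hE // e.
  case: q q' e1 e {qT q'T} => [z [a1 b1]] [z' [a1' b1']] /= <- [] /addrI/oppr_inj.
  by move/(mulfI xi0) => <- /addIr <-.
have c_gt0 : 0 < gamma ^+ 5 * n ^+ 2 / 4096.
  apply: divr_gt0; last by rewrite ltr0n.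
  by apply: mulr_gt0; apply: exprn_gt0.
rewrite -(ler_pM2r c_gt0); apply: le_trans count _.
have D3 : #|D|%:R ^+ 3 <= (4 * K1 * gamma ^+ 2 * n) ^+ 3.
  apply: lerXn2r; rewrite ?nnegrE ?ler0n //; exact: le_trans D_le'.
apply: le_trans D3 _; rewrite le_eqVlt; apply/orP; left; apply/eqP; by rewrite -/w wE; field.
Qed.

(** * Finding a pivot dilate *)

(** Cauchy-Schwarz for the multiplicity [c t] bounds the sum of all [|S i :&: S j|] from below; [i0]
    is the best row. Intersections under the threshold supply at most half of that row. *)
Lemma popular_intersection (R : realFieldType) (I T : finType) (Y : {set I})
    (O : {set T}) (S : I -> {set T}) (s : R) :
    Y != set0 -> O != set0 -> 0 <= s ->
    (forall i, i \in Y -> S i \subset O /\ s <= #|S i|%:R) ->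
  exists2 i0, i0 \in Y &
    #|Y|%:R * s ^+ 2 <= 2 * #|O|%:R ^+ 2 *
      #|[set i in Y | s ^+ 2 / (2 * #|O|%:R) <= #|S i :&: S i0|%:R]|%:R.
Proof.
move=> Y0 O0 s_ge0 SP; have o_gt0 : 0 < #|O|%:R :> R by rewrite ltr0n card_gt0.
have y_gt0 : 0 < #|Y|%:R :> R by rewrite ltr0n card_gt0.
pose c t := #|[set i in Y | t \in S i]|.
have c1 : (\sum_(t in O) c t = \sum_(i in Y) #|S i|)%N.
  rewrite -double_count; apply: eq_bigr => i iY; congr #|pred_of_set _|.
  by apply/setP=> t; rewrite inE andb_idl //; apply/subsetP; case: (SP i iY).
have c2 : (\sum_(t in O) c t ^ 2 = \sum_(j in Y) \sum_(i in Y) #|S i :&: S j|)%N.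
  have E t : (c t ^ 2 = \sum_(j in Y) \sum_(i in Y) ((t \in S i) && (t \in S j)))%N.
    rewrite expnS expn1 /c card_setIn_sum big_distrr /=; apply: eq_bigr => j _.
    by rewrite big_distrl /=; apply: eq_bigr => i _; rewrite mulnb.
  under eq_bigr do rewrite E.
  rewrite exchange_big /=; apply: eq_bigr => j jY.
  rewrite exchange_big /=; apply: eq_bigr => i iY.
  rewrite -card_setIn_sum; congr #|pred_of_set _|; apply/setP=> t; rewrite !inE.
  rewrite andb_idl // => /andP[ti _]; have [/subsetP sub _] := SP i iY; exact: sub.
have [i0 i0Y i0max] : exists2 i0, i0 \in Y &
    (\sum_(t in O) c t ^ 2 <= #|Y| * \sum_(i in Y) #|S i :&: S i0|)%N.
  case/set0Pn: (Y0) => j jY.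
  case: (@arg_maxnP _ j (mem Y) (fun j => \sum_(i in Y) #|S i :&: S j|)%N jY) => i0 i0Y imax.
  by exists i0 => //; rewrite c2 -sum_nat_const; apply: leq_sum => i; apply: imax.
exists i0 => //; set Y' := [set i in Y | _].
have H1 : (#|Y|%:R * s) ^+ 2 <= #|O|%:R * (\sum_(t in O) c t ^ 2)%:R :> R.
  apply: le_trans (_ : (\sum_(t in O) c t)%:R ^+ 2 <= _).
    apply: lerXn2r; rewrite ?nnegrE ?ler0n ?mulr_ge0 //.
    rewrite c1 natr_sum mulr_natl -sumr_const; apply: ler_sum => i iY.
    by case: (SP i iY).
  rewrite !natr_sum; apply: le_trans (sum_sqr_ge _ _) _; apply: ler_wpM2l => //.
  by apply: ler_sum => t _; rewrite natrX.
have H2 : (\sum_(i in Y) #|S i :&: S i0|)%:R <=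
    #|Y'|%:R * #|O|%:R + #|Y|%:R * (s ^+ 2 / (2 * #|O|%:R)) :> R.
  rewrite natr_sum (bigID (mem Y')) /=; apply: lerD.
    rewrite mulr_natl -sumr_const (eq_bigl (mem Y')); last first.
      by move=> i; rewrite andb_idl // => /setIdP[].
    apply: ler_sum => i /setIdP[iY _]; rewrite ler_nat; apply: subset_leq_card.
    by apply: subset_trans (subsetIl _ _) _; case: (SP i iY).
  have p_ge0 : 0 <= s ^+ 2 / (2 * #|O|%:R).
    by apply: divr_ge0; [apply: sqr_ge0|apply: mulr_ge0; rewrite ?ltW].
  rewrite mulr_natl -sumr_const [leRHS](bigID (mem Y')) /= -[leLHS]add0r; apply: lerD.
    exact: sumr_ge0.
  apply: ler_sum => i /andP[iY iY']; rewrite leNgt; apply: contra iY' => /ltW lt.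
  exact/setIdP.
have H3 : #|Y|%:R * s ^+ 2 <= #|O|%:R * (\sum_(i in Y) #|S i :&: S i0|)%:R.
  rewrite -(ler_pM2l y_gt0) mulrA -expr2 -exprMn; apply: le_trans H1 _.
  by rewrite mulrCA; apply: ler_wpM2l; rewrite // -natrM ler_nat.
have := le_trans H3 (ler_wpM2l (ltW o_gt0) H2).
have -> : #|O|%:R * (#|Y'|%:R * #|O|%:R + #|Y|%:R * (s ^+ 2 / (2 * #|O|%:R))) =
   #|O|%:R ^+ 2 * #|Y'|%:R + #|Y|%:R * s ^+ 2 / 2 :> R.
  by field; rewrite gt_eqF.
rewrite -[2 * _ * _]mulrA.
move: (#|Y|%:R * s ^+ 2) (#|O|%:R ^+ 2 * _) => u v; lra.
Qed.

(** * Ruzsa and Plunnecke inequalities for dilates *)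

Section Covering.
Variable F : finFieldType.
Implicit Types (A B C D : {set F}) (x y c : F).

Lemma dilate_diffset c A B : dilate c (diffset A B) = diffset (dilate c A) (dilate c B).
Proof. by rewrite !diffsetE dilate_sumset !dilate_dilate mulrC. Qed.

Lemma diffset_dilate A B c : diffset A (dilate c B) = sumset A (dilate (- c) B).
Proof. by rewrite diffsetE dilate_dilate mulN1r. Qed.

Lemma ruzsa_diff A B C :
  (#|diffset A C| * #|B| <= #|diffset A B| * #|diffset B C|)%N.
Proof. by rewrite !(diffsetE _ C) ruzsa_sum. Qed.

Lemma card_diffset_sub A B C D :
  A \subset C -> B \subset D -> (#|diffset A B| <= #|diffset C D|)%N.
Proof. by move=> AC BD; rewrite subset_leq_card ?diffsetS. Qed.

(** Control of the dilate [y] on subsets is extended to [A] and [B] by the Ruzsa chain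
    [A, A', y * B', y * B]. The two intermediate sets [A - A] and [B - B] are bounded through [x],
    each at the cost of [|A - x * B|^2]. *)
Lemma card_diffset_chain A A' B B' x y : x != 0 -> y != 0 ->
    A' \subset A -> B' \subset B ->
  (#|diffset A (dilate y B)| * (#|A'| * #|B'|) * (#|A| * #|B|) <=
   #|diffset A (dilate x B)| ^ 4 * #|diffset A' (dilate y B')|)%N.
Proof.
move=> x0 y0 A'A B'B.
have H1 := ruzsa_diff A A' (dilate y B).
have H2 := ruzsa_diff A' (dilate y B') (dilate y B).
rewrite -dilate_diffset !card_dilate // in H2.
have H3 := ruzsa_diff A (dilate x B) A.
rewrite card_dilate // [#|diffset (dilate x B) A|]card_diffsetC in H3.
have H4 := ruzsa_diff (dilate x B) A (dilate x B).
rewrite -dilate_diffset !card_dilate // [#|diffset (dilate x B) A|]card_diffsetC in H4.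
have H3' := card_diffset_sub (subxx A) A'A.
have H4' := card_diffset_sub B'B (subxx B).
set d := #|diffset A (dilate x B)| in H3 H4 *.
set e := #|diffset A' (dilate y B')| in H2 *.
have {H1} H12 := leq_mul H1 (leqnn #|B'|).
have {}H12 : (#|diffset A (dilate y B)| * (#|A'| * #|B'|) <=
    #|diffset A A| * (e * #|diffset B B|))%N.
  rewrite mulnA; apply: leq_trans H12 _; rewrite -mulnA.
  apply: leq_mul => //; apply: leq_trans H2 _; exact: leq_mul.
apply: leq_trans (leq_mul H12 (leqnn _)) _.
have -> : (#|diffset A A| * (e * #|diffset B B|) * (#|A| * #|B|) =
   (#|diffset A A| * #|B|) * (#|diffset B B| * #|A|) * e)%N by ring.
have -> : (d ^ 4 * e = (d * d) * (d * d) * e)%N by ring.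
by rewrite leq_mul2r leq_mul ?orbT.
Qed.

Lemma card_shifted_sum A B a x : A \subset Defs.shift B a ->
  (#|sumset A (dilate x A)| <= #|sumset B (dilate x B)|)%N.
Proof.
move=> /subsetP AB; pose f z : F := z - (a + x * a).
apply: leq_trans (leq_imset_card f _); apply/subset_leq_card/subsetP=> z.
case/imset2P=> u' t /AB/imsetP[u uB ->] /imsetP[v' /AB/imsetP[v vB ->] ->] ->.
by apply/imsetP; exists (u + x * v); rewrite ?mem_sumset ?mem_dilate // /f; ring.
Qed.

Lemma card_diffset_le_sum_diffset B C : B != set0 ->
  (#|diffset C B| <= #|diffset (sumset B C) (sumset B B)|)%N.
Proof.
move=> B0; rewrite -diffset_diffset; apply: leq_trans (card_diffset_ge _ B0).
by rewrite !diffsetE -sumsetA [sumset B _]sumsetC card_sumset_ge.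
Qed.

End Covering.

Section PlunneckeDilates.
Variables (R : realFieldType) (F : finFieldType) (A B : {set F}) (x : F) (delta : R).
Hypotheses (A0 : A != set0) (B0 : B != set0) (x0 : x != 0).
Hypothesis doubling : #|diffset A (dilate x B)|%:R <= delta * #|A|%:R.

Lemma plunnecke_pivot : exists S : {set F}, [/\ S \subset A, S != set0,
    #|sumset S (dilate (- x) B)|%:R <= delta * #|S|%:R &
    forall C, #|sumset (sumset S (dilate (- x) B)) C|%:R <= delta * #|sumset S C|%:R].
Proof.
have [S [SA S0 HS PS]] := petridis (dilate (- x) B) A0.
have s_gt0 : 0 < #|S|%:R :> R by rewrite ltr0n card_gt0.
have a_gt0 : 0 < #|A|%:R :> R by rewrite ltr0n card_gt0.
have D1 : #|sumset S (dilate (- x) B)|%:R <= delta * #|S|%:R.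
  rewrite -(ler_pM2r a_gt0) -natrM.
  apply: le_trans (_ : (#|sumset A (dilate (- x) B)| * #|S|)%:R <= _).
    by rewrite ler_nat.
  by rewrite natrM -diffset_dilate mulrAC; apply: ler_wpM2r.
exists S; split=> // C; rewrite -(ler_pM2r s_gt0) -natrM.
apply: le_trans (_ : (#|sumset S (dilate (- x) B)| * #|sumset S C|)%:R <= _).
  by rewrite ler_nat.
by rewrite natrM mulrAC; apply: ler_wpM2r.
Qed.

(** Scaling by [-x] leads to [(N - y * B) - (N + N)] with [N = -x * B]. The triangle inequality
    through the Petridis set [S] costs one [delta] for [S + N - y * B] and two for [S + N + N]. This
    trades the pair [A, B] for [B] alone, with [y / x] in place of [y]; hence the normalization by
    [x0^-1]. *)
Lemma card_growth_le y : y != 0 ->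
  #|diffset (sumset B (dilate (y / x) B)) (sumset B B)|%:R <=
    delta ^+ 3 * #|diffset A (dilate y B)|%:R.
Proof.
move=> y0; have [S [SA S0 D1 DS]] := plunnecke_pivot.
have s_gt0 : 0 < #|S|%:R :> R by rewrite ltr0n card_gt0.
set N := dilate (- x) B in D1 DS.
have d_ge0 : 0 <= delta.
  rewrite -(pmulr_lge0 _ s_gt0); exact: le_trans (ler0n _ _) D1.
have Nx : - x != 0 by rewrite oppr_eq0.
have -> : #|diffset (sumset B (dilate (y / x) B)) (sumset B B)| =
    #|diffset (sumset N (dilate (- y) B)) (sumset N N)|.
  rewrite -(card_dilate _ Nx) dilate_diffset !dilate_sumset dilate_dilate.
  by rewrite mulNr mulrCA divff ?mulr1.
have := ruzsa_triangle (sumset N (dilate (- y) B)) (sumset N N) S.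
rewrite -(ler_nat R) !natrM => H; rewrite -(ler_pM2r s_gt0); apply: le_trans H _.
have H1 : #|sumset (sumset N (dilate (- y) B)) S|%:R <= delta * #|diffset A (dilate y B)|%:R.
  rewrite sumsetC sumsetA; apply: le_trans (DS _) _; apply: ler_wpM2l => //.
  by rewrite diffset_dilate ler_nat subset_leq_card // sumsetS.
have H2 : #|sumset (sumset N N) S|%:R <= delta ^+ 2 * #|S|%:R.
  rewrite sumsetC sumsetA; apply: le_trans (DS _) _.
  by rewrite expr2 -mulrA; apply: ler_wpM2l.
apply: le_trans (ler_pM (ler0n _ _) (ler0n _ _) H1 H2) _.
by rewrite le_eqVlt; apply/orP; left; apply/eqP; ring.
Qed.

Lemma card_doubling_le :
  #|diffset (sumset B B) (sumset B B)|%:R <= delta ^+ 3 * #|diffset A (dilate x B)|%:R.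
Proof. by have := card_growth_le x0; rewrite divff // dilate1. Qed.

End PlunneckeDilates.

(** * The case of a pointwise energy bound *)

Lemma shiftS (F : finFieldType) (A B : {set F}) a :
  A \subset B -> Defs.shift A a \subset Defs.shift B a.
Proof. exact: imsetS. Qed.

Section Pointwise.
Variables (R : realFieldType) (F : finFieldType) (A X : {set F}) (K : R).
Hypotheses (A0 : A != set0) (X0 : X != set0) (zero_notin_X : 0 \notin X) (K_gt0 : 0 < K).
Hypothesis energy_large : forall xi, xi \in X -> #|A|%:R ^+ 3 / K <= (energy A xi)%:R.

Let n : R := #|A|%:R.
Let l := (trunc_log 2 (#|A| ^ 2)).+1.
Let w : R := 256 * l%:R * K.

Lemma energy_bound_ge1 : 1 <= K.
Proof.
case/set0Pn: X0 => xi /energy_large; rewrite ler_pdivrMr // => H.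
have n3_gt0 : 0 < n ^+ 3 by rewrite exprn_gt0 // ltr0n card_gt0.
rewrite -(ler_pM2l n3_gt0) mulr1; apply: le_trans H _; apply: ler_wpM2r; first exact: ltW.
by rewrite -natrX ler_nat energy_le_cube.
Qed.

(** With [b = w^26] and [kappa = w^12], the exponents are [204 = 4 * 12 + 6 * 26], [38 = 12 + 26]
    and [52 = 26 + 26], the last two because [|B| <= 2 * w^26 * |A1|]; 27 has one further [w] for
    the density [s] of [B] in [A]. *)
Lemma structured_subsets_pointwise :
  exists (abar x0 : F) (A1 X' : {set F}),
    [/\ abar \in A, x0 \in X,
        A1 \subset Defs.shift A abar & X' \subset dilate x0^-1 X]
    /\ [/\ n <= w ^+ 27 * #|A1|%:R /\ #|X|%:R <= l%:R * w ^+ 4 * #|X'|%:R,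
           #|sumset A1 (prodset X' A1)|%:R <= 256 * w ^+ 204 * #|A1|%:R,
           #|sumset A1 A1|%:R <= 2 * w ^+ 38 * #|A1|%:R
             /\ #|diffset A1 A1|%:R <= 2 * w ^+ 38 * #|A1|%:R
         & forall x', x' \in X' ->
             #|sumset A1 (dilate x' A1)|%:R <= 2 * w ^+ 52 * #|A1|%:R
             /\ #|diffset A1 (dilate x' A1)|%:R <= 2 * w ^+ 52 * #|A1|%:R].
Proof.
have n_gt0 : 0 < n by rewrite ltr0n card_gt0.
have w_ge1 : 1 <= w.
  have l1 : 1 <= l%:R :> R by rewrite ler1n.
  have := ler_pM ler01 ler01 l1 energy_bound_ge1; rewrite mulr1.
  by rewrite /w -mulrA; lra.
have w_gt0 : 0 < w by lra.
have X_neq0 xi : xi \in X -> xi != 0 by move=> xX; apply: contraNneq zero_notin_X => <-.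
have ex xi : exists t : 'I_l * ({set F} * {set F}), xi \in X ->
    let s := (2 ^ t.1)%:R / 8 / n ^+ 2 in
    [/\ t.2.1 \subset A, t.2.2 \subset A, s * n <= #|t.2.1|%:R, s * n <= #|t.2.2|%:R &
        2 <= w * s /\ #|diffset t.2.1 (dilate xi t.2.2)|%:R <= w ^+ 3 * s * n].
  (* Outside [X] a dummy value makes the choice function total. *)
  have [xX|xX] := boolP (xi \in X); last by exists (ord0, (set0, set0)); move/negP: xX.
  have [j [A' [B' H]]] := popular_subsets (X_neq0 _ xX) K_gt0 A0 (energy_large xX).
  by exists (j, (A', B')).
have [f fP] := fin_all_exists ex.
have fI : {in X, forall xi, (f xi).1 \in [set: 'I_l]} by move=> xi _; rewrite in_setT.
have [j _] := large_fiber X0 fI; rewrite cardsT card_ord; set Y := [set xi in X | _] => cXY.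
have YP xi : xi \in Y -> xi \in X /\ (f xi).1 = j by case/setIdP=> xX /eqP.
have YX : Y \subset X by apply/subsetP=> xi /YP[].
have Y0 : Y != set0.
  by rewrite -card_gt0; move: cXY; rewrite lt0n; apply: contraTneq => ->; rewrite muln0 -ltnNge card_gt0.
pose s : R := (2 ^ j)%:R / 8 / n ^+ 2.
pose As xi := (f xi).2.1; pose Bs xi := (f xi).2.2.
have AB xi : xi \in Y -> [/\ As xi \subset A, Bs xi \subset A, s * n <= #|As xi|%:R,
    s * n <= #|Bs xi|%:R & 2 <= w * s /\ #|diffset (As xi) (dilate xi (Bs xi))|%:R <= w ^+ 3 * s * n].
  by move=> /YP[xX e]; have := fP xi xX; rewrite /= e.
have s_gt0 : 0 < s by rewrite !divr_gt0 ?exprn_gt0 // ltr0n expn_gt0.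
have ws_ge2 : 2 <= w * s by case/set0Pn: Y0 => xi /AB[_ _ _ _ []].
have sn_gt0 : 0 < s * n by rewrite mulr_gt0.
(* Intersecting the products, rather than one factor, makes both members of a pair overlap with
   those of [x0]. They have density [s^2] in [O], which yields the loss [s^4], that is [w^4], for
   [X']. *)
pose S xi := setX (As xi) (Bs xi); pose O := setX A A.
have O0 : O != set0 by rewrite -card_gt0 cardsX muln_gt0 card_gt0 A0.
have SP xi : xi \in Y -> S xi \subset O /\ (s * n) ^+ 2 <= #|S xi|%:R.
  move=> /AB[AA BA cA cB _]; split.
    by apply/subsetP=> -[a c] /setXP[aA cB']; rewrite in_setX (subsetP AA) ?(subsetP BA).
  by rewrite cardsX natrM expr2; apply: ler_pM => //; apply: ltW.
have [x0 x0Y] := popular_intersection Y0 O0 (sqr_ge0 (s * n)) SP.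
rewrite cardsX natrM -/n -expr2; set Y' := [set _ in Y | _] => cY.
have [x0X _] := YP _ x0Y; have x0_neq0 := X_neq0 _ x0X.
have [A0A B0A cA0 cB0 [_ d0]] := AB _ x0Y.
set A' := As x0 in A0A cA0 d0; set B := Bs x0 in B0A cB0 d0.
have A'_neq0 : A' != set0 by rewrite -card_gt0 -(ltr0n R); apply: lt_le_trans cA0.
have B_neq0 : B != set0 by rewrite -card_gt0 -(ltr0n R); apply: lt_le_trans cB0.
have w3_ge0 : 0 <= w ^+ 3 by apply/exprn_ge0/ltW.
have doubl : #|diffset A' (dilate x0 B)|%:R <= w ^+ 3 * #|A'|%:R.
  by apply: le_trans d0 _; rewrite -mulrA; apply: ler_wpM2l.
(* [card_diffset_chain] gives [(w^3 * s * n)^5] over [(s * n)^6 / (2 * n^2)]. *)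
have far y : y \in Y' -> #|diffset A' (dilate y B)|%:R * s <= 2 * w ^+ 15 * n.
  case/setIdP=> yY cI; have [yX _] := YP _ yY; have [AyA ByA _ _ [_ dy]] := AB _ yY.
  have H : #|diffset A' (dilate y B)|%:R * (#|As y :&: A'|%:R * #|Bs y :&: B|%:R) *
      (#|A'|%:R * #|B|%:R) <= #|diffset A' (dilate x0 B)|%:R ^+ 4 *
      #|diffset (As y :&: A') (dilate y (Bs y :&: B))|%:R :> R.
    rewrite -natrX -!natrM ler_nat.
    exact: card_diffset_chain x0_neq0 (X_neq0 _ yX) (subsetIr _ _) (subsetIr _ _).
  have I1 : (s * n) ^+ 4 / (2 * n ^+ 2) <= #|As y :&: A'|%:R * #|Bs y :&: B|%:R.
    have -> : (s * n) ^+ 4 = (s * n) ^+ 2 ^+ 2 by ring.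
    apply: le_trans cI _; rewrite -natrM -cardsX ler_nat.
    apply/subset_leq_card/subsetP=> -[a c].
    by rewrite !in_setI !in_setX !in_setI => /andP[/andP[-> ->] /andP[-> ->]].
  have I2 : (s * n) ^+ 2 <= #|A'|%:R * #|B|%:R by rewrite expr2; apply: ler_pM => //; apply: ltW.
  have I3 : #|diffset (As y :&: A') (dilate y (Bs y :&: B))|%:R <= w ^+ 3 * s * n.
    apply: le_trans dy; rewrite ler_nat card_diffset_sub ?subsetIl //.
    by apply: imsetS; apply: subsetIl.
  have c4_ge0 : 0 <= (s * n) ^+ 4 / (2 * n ^+ 2).
    by apply: divr_ge0; [apply/exprn_ge0/ltW|apply: mulr_ge0 => //; apply: sqr_ge0].
  have c2_ge0 : 0 <= (s * n) ^+ 2 by apply: sqr_ge0.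
  have {}H : #|diffset A' (dilate y B)|%:R * ((s * n) ^+ 4 / (2 * n ^+ 2)) * (s * n) ^+ 2 <=
      (w ^+ 3 * s * n) ^+ 4 * (w ^+ 3 * s * n).
    apply: le_trans (le_trans H _).
      apply: ler_pM => //; first by rewrite mulr_ge0.
      by apply: ler_wpM2l.
    apply: ler_pM; rewrite ?ler0n ?exprn_ge0 //.
    by apply: lerXn2r; rewrite ?nnegrE ?ler0n //; apply: le_trans d0; apply: ler0n.
  have p_gt0 : 0 < s ^+ 5 * n ^+ 4 / 2.
    by apply: divr_gt0 => //; apply: mulr_gt0; apply: exprn_gt0.
  rewrite -(ler_pM2r p_gt0).
  have -> : #|diffset A' (dilate y B)|%:R * s * (s ^+ 5 * n ^+ 4 / 2) =
      #|diffset A' (dilate y B)|%:R * ((s * n) ^+ 4 / (2 * n ^+ 2)) * (s * n) ^+ 2.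
    by field; rewrite gt_eqF.
  by apply: le_trans H _; rewrite le_eqVlt; apply/orP; left; apply/eqP; field.
pose X' := dilate x0^-1 Y'.
have Y'Y : Y' \subset Y by apply/subsetP=> y /setIdP[].
have X'X : X' \subset dilate x0^-1 X by apply: imsetS; apply: subset_trans Y'Y YX.
have cX' : #|X'| = #|Y'| by rewrite card_dilate ?invr_eq0.
have zX' : 0 \notin X'.
  apply/negP=> /imsetP[y yY' /esym/eqP]; rewrite mulf_eq0 invr_eq0 (negPf x0_neq0) /=.
  by apply/negP; apply: X_neq0; apply: (subsetP YX); apply: (subsetP Y'Y).
have w9 : 0 <= (w ^+ 3) ^+ 3 by apply: exprn_ge0.
have growB x : x \in X' -> #|diffset (sumset B (dilate x B)) (sumset B B)|%:R <= w ^+ 26 * #|B|%:R.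
  case/imsetP=> y yY' ->; have yX := subsetP YX _ (subsetP Y'Y _ yY').
  rewrite mulrC; apply: le_trans (card_growth_le A'_neq0 x0_neq0 doubl (X_neq0 _ yX)) _.
  rewrite -(ler_pM2r s_gt0) -mulrA.
  apply: le_trans (ler_wpM2l w9 (far _ yY')) _.
  (* The bound is [n / s] up to constants and powers of [w], whereas [s * n] is needed; two factors
     [w * s] make up for it. *)
  apply: le_trans (_ : w ^+ 24 * ((w * s) ^+ 2 * n) <= _).
    have -> : (w ^+ 3) ^+ 3 * (2 * w ^+ 15 * n) = w ^+ 24 * (2 * n) by ring.
    apply: ler_wpM2l; first by apply/exprn_ge0/ltW.
    by apply: ler_wpM2r; [apply: ltW|nra].
  have -> : w ^+ 24 * ((w * s) ^+ 2 * n) = w ^+ 26 * s * (s * n) by ring.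
  rewrite [leRHS]mulrAC; apply: ler_wpM2l => //; apply: mulr_ge0; last exact: ltW.
  by apply/exprn_ge0/ltW.
have doubB : #|diffset (sumset B B) (sumset B B)|%:R <= w ^+ 12 * #|B|%:R.
  apply: le_trans (card_doubling_le A'_neq0 x0_neq0 doubl) _.
  apply: le_trans (ler_wpM2l w9 d0) _.
  have -> : (w ^+ 3) ^+ 3 * (w ^+ 3 * s * n) = w ^+ 12 * (s * n) by ring.
  by apply: ler_wpM2l => //; apply/exprn_ge0/ltW.
have [abar aB [A1 [A1B cB cA1]]] := structured_subset zX' B_neq0
  (exprn_ege1 26 w_ge1) (exprn_ege1 12 w_ge1) growB doubB.
have A1_le (c m : nat) (Z : {set F}) : (c = m + 26)%N -> #|Z|%:R <= w ^+ m * #|B|%:R ->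
    #|Z|%:R <= 2 * w ^+ c * #|A1|%:R.
  move=> -> ZB; apply: le_trans ZB _.
  have -> : 2 * w ^+ (m + 26) * #|A1|%:R = w ^+ m * (2 * w ^+ 26 * #|A1|%:R) by rewrite exprD; ring.
  by apply: ler_wpM2l => //; apply/exprn_ge0/ltW.
have BB0 : sumset B B != set0 by apply: sumset_neq0.
exists abar, x0, A1, X'; split.
  split=> //; first exact: (subsetP B0A).
  exact: subset_trans A1B (shiftS _ B0A).
split.
- split.
    have H : n * 2 <= n * (w * s) by apply: ler_wpM2l => //; apply: ltW.
    have H' : w * (s * n) <= w * (2 * w ^+ 26 * #|A1|%:R).
      by apply: ler_wpM2l (le_trans cB0 cB); apply: ltW.
    have e1 : w * (2 * w ^+ 26 * #|A1|%:R) = 2 * (w ^+ 27 * #|A1|%:R) by ring.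
    have e2 : n * (w * s) = w * (s * n) by ring.
    move: H H'; rewrite e1 e2; lra.
  apply: le_trans (_ : l%:R * #|Y|%:R <= _); first by rewrite -natrM ler_nat.
  rewrite -mulrA; apply: ler_wpM2l => //; rewrite cX'.
  have n4 : 0 < n ^+ 4 by apply: exprn_gt0.
  have {}cY : #|Y|%:R * s ^+ 4 <= 2 * #|Y'|%:R.
    rewrite -(ler_pM2r n4).
    have -> : #|Y|%:R * s ^+ 4 * n ^+ 4 = #|Y|%:R * (s * n) ^+ 4 by ring.
    have -> : 2 * #|Y'|%:R * n ^+ 4 = 2 * n ^+ 4 * #|Y'|%:R by ring.
    have -> : (s * n) ^+ 4 = (s * n) ^+ 2 ^+ 2 by ring.
    by have -> : n ^+ 4 = n ^+ 2 ^+ 2 by ring.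
  have ws4 : 16 <= (w * s) ^+ 4.
    have -> : 16 = 2 ^+ 4 :> R by ring.
    by apply: lerXn2r; rewrite ?nnegrE //; apply: le_trans ws_ge2.
  have H1 : #|Y|%:R * 16 <= #|Y|%:R * (w * s) ^+ 4 by apply: ler_wpM2l.
  have w4 : 0 <= w ^+ 4 by apply/exprn_ge0/ltW.
  have H2 := ler_wpM2l w4 cY.
  have e1 : #|Y|%:R * (w * s) ^+ 4 = w ^+ 4 * (#|Y|%:R * s ^+ 4) by ring.
  have e2 : w ^+ 4 * (2 * #|Y'|%:R) = 2 * (w ^+ 4 * #|Y'|%:R) by ring.
  have : 0 <= w ^+ 4 * #|Y'|%:R by apply: mulr_ge0.
  have aux (u v y : R) : y * 16 <= u -> u <= 2 * v -> 0 <= v -> y <= v by lra.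
  by rewrite e1 in H1; rewrite e2 in H2; apply: aux H1 H2.
- have e : (w ^+ 12) ^+ 4 * (w ^+ 26) ^+ 6 = w ^+ 204 by rewrite -!exprM -exprD.
  move: cA1; have -> : 256 * (w ^+ 12) ^+ 4 * (w ^+ 26) ^+ 6 =
    256 * ((w ^+ 12) ^+ 4 * (w ^+ 26) ^+ 6) by rewrite mulrA.
  by rewrite e.
- split; apply: (A1_le 38 12) => //; apply: le_trans doubB; rewrite ler_nat.
    apply: leq_trans (card_diffset_ge _ BB0).
    by have := card_shifted_sum 1 A1B; rewrite !dilate1.
  apply: leq_trans (card_diffset_le_sum_diffset B B_neq0).
  by have := card_shifted_sum (-1) A1B; rewrite -!diffsetE.
move=> x xX'; split; apply: (A1_le 52 26) => //; apply: le_trans (growB x xX'); rewrite ler_nat.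
  exact: leq_trans (card_shifted_sum x A1B) (card_diffset_ge _ BB0).
rewrite diffset_dilate; apply: leq_trans (card_shifted_sum _ A1B) _.
by rewrite -diffset_dilate card_diffsetC card_diffset_le_sum_diffset.
Qed.

End Pointwise.

(** * Conclusion *)

Lemma mulr_expr_le (R : realFieldType) (lam w K c : R) (a m N : nat) :
    0 <= c <= lam -> 0 <= w <= lam * K -> 1 <= lam -> 1 <= K ->
    (a < N)%N -> (a <= m)%N ->
  c * w ^+ a <= lam ^+ N * K ^+ m.
Proof.
move=> /andP[c0 cl] /andP[w0 wl] l1 K1 aN am.
apply: le_trans (_ : lam ^+ a.+1 * K ^+ a <= _); last first.
  apply: ler_pM; rewrite ?exprn_ge0 ?ler_weXn2l //; lra.
rewrite exprS -mulrA -exprMn; apply: ler_pM; rewrite ?exprn_ge0 //.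
by apply: lerXn2r; rewrite ?nnegrE //; apply: le_trans wl.
Qed.

(** The logarithm itself accounts for [2 * ln q]; the successor costs another [ln 2], at most
    [ln q]. *)
Lemma trunc_log_le_ln (R : realType) (m q : nat) : (0 < m <= q ^ 2)%N -> (1 < q)%N ->
  (trunc_log 2 m).+1%:R <= 3 * ln q%:R / ln 2 :> R.
Proof.
case/andP=> m_gt0 mq q_gt1.
have q_pos : 0 < q%:R :> R by rewrite ltr0n ltnW.
have ln2_gt0 : 0 < ln 2 :> R by rewrite ln_gt0 ?ltr1n.
have lnq : ln 2 <= ln q%:R :> R by rewrite ler_ln ?posrE // ler_nat.
have H : (trunc_log 2 m)%:R * ln 2 <= 2 * ln q%:R :> R.
  rewrite !mulr_natl -!lnXn // -!natrX ler_ln ?posrE ?ltr0n ?expn_gt0 ?(ltnW q_gt1) //.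
  by rewrite ler_nat; apply: leq_trans mq; have /andP[] := @trunc_log_bounds 2 m isT m_gt0.
by rewrite ler_pdivlMr // -natr1 mulrDl mul1r; lra.
Qed.

Section Conclusion.
Variables (R : realType) (F : finFieldType) (A X X1 : {set F}) (K K1 r lam : R) (m N : nat).
Hypotheses (A0 : A != set0) (X10 : X1 != set0) (X0 : 0 \notin X1) (X1X : X1 \subset X).
Hypotheses (K_ge1 : 1 <= K) (K1_gt0 : 0 < K1) (N_large : (204 < N)%N) (lam_ge : 256 <= lam).
Let l := (trunc_log 2 (#|A| ^ 2)).+1.
Hypothesis energy_large : forall xi, xi \in X1 -> #|A|%:R ^+ 3 / K1 <= (energy A xi)%:R.
Hypothesis w_le : 256 * l%:R * K1 <= lam * K.
Hypothesis X1_large : #|X|%:R <= r * #|X1|%:R.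
Hypothesis r_ge0 : 0 <= r.
Hypothesis r_le : r * (l%:R * (256 * l%:R * K1) ^+ 4) <= lam ^+ N * K ^+ m.

(** Serves both hypotheses on the energy: [r] is the loss in passing from [X] to [X1] and [K1] the
    energy parameter on [X1]. Both are [2 * K] for the bound on average; they are 1 and [K] for the
    pointwise one. *)
Lemma structured_subsets_of_pointwise : structured_subsets (lam ^+ N) K m A X.
Proof.
have [abar [x0 [A1 [X' [[aA x0X A1A X'X] [[cA cX] c1 [c2 c3] c4]]]]]] :=
  structured_subsets_pointwise A0 X10 X0 K1_gt0 energy_large.
pose w := 256 * l%:R * K1; rewrite -/l -/w in cA cX c1 c2 c3 c4.
have w_ge0 : 0 <= w by rewrite !mulr_ge0 // ltW.
have w_bnd : 0 <= w <= lam * K by rewrite w_ge0 w_le.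
have lam1 : 1 <= lam by have := lam_ge; lra.
have L_gt0 : 0 < lam ^+ N by apply: exprn_gt0; lra.
have K_gt0 : 0 < K by have := K_ge1; lra.
have bound c a e (z t : R) : 0 <= t -> 0 <= c <= 256 -> (a <= 204)%N -> (a <= e)%N ->
    z <= c * w ^+ a * t -> z <= lam ^+ N * K ^+ e * t.
  move=> t0 /andP[c0 cl] a204 ae; move/le_trans; apply; apply: ler_wpM2r => //.
  apply: mulr_expr_le => //; first by rewrite c0 (le_trans cl).
  exact: leq_ltn_trans a204 N_large.
have inv_bound e (z t : R) : z <= lam ^+ N * K ^+ e * t -> (lam ^+ N)^-1 * K ^- e * z <= t.
  have p_gt0 : 0 < lam ^+ N * K ^+ e by apply: mulr_gt0 => //; apply: exprn_gt0.
  by move=> H; rewrite -invfM [leLHS]mulrC ler_pdivrMr // [leRHS]mulrC.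
exists abar, x0, A1, X'; split.
  split=> //; first exact: (subsetP X1X).
  by apply: subset_trans X'X _; apply: imsetS.
split.
- split; apply: inv_bound.
    by apply: (bound 1 27) => //; rewrite ?mul1r ?ler01 ?ler1n.
  apply: le_trans X1_large _; apply: le_trans (ler_wpM2l r_ge0 cX) _.
  by rewrite mulrA; apply: ler_wpM2r.
- by apply: (bound 256 204) c1 => //; rewrite lexx ler0n.
- by split; [apply: (bound 2 38) c2|apply: (bound 2 38) c3]; rewrite // ler0n ler_nat.
move=> x' /c4[c5 c6].
by split; [apply: (bound 2 52) c5|apply: (bound 2 52) c6]; rewrite // ler0n ler_nat.
Qed.

End Conclusion.

Theorem proposition4 (R : realType) :
  exists C k : R, [/\ 0 < C, 0 < k &
    forall (F : finFieldType) (A X : {set F}) (K : R),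
      let L : R := C * (ln (#|F|%:R : R)) `^ k in
      A != finset.set0 -> X != finset.set0 ->
      0 \notin A -> 0 \notin X -> 0 < K ->
      ((#|A|%:R ^+ 3 * #|X|%:R / K <= \sum_(xi in X) ((energy A xi)%:R : R)) ->
         structured_subsets L K 5 A X)
      /\ ((forall xi, xi \in X ->
             #|A|%:R ^+ 3 / K <= ((energy A xi)%:R : R)) ->
         structured_subsets L K 4 A X)].
Proof.
(* The highest power of [w] is 204; one more factor [lam] absorbs the numerical constants. *)
pose N := 205%N; have NE : (204 < N)%N by [].
have N5 : (5 < N)%N by []. have N_gt0 : (0 < N)%N by [].
have ln2_gt0 : 0 < ln 2 :> R by rewrite ln_gt0 ?ltr1n.
(* Since [l <= 3 * ln q / ln 2], the value [1536 = 3 * 512] gives [512 * l <= lam]. Here 512 is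
   twice the 256 of [w], to allow for [2 * K] in place of [K]. *)
pose c : R := 1536 / ln 2; have c_gt0 : 0 < c by apply: divr_gt0 ln2_gt0; rewrite ltr0n.
exists (c ^+ N), N%:R; split; [exact: exprn_gt0|by rewrite ltr0n|].
clearbody N; move=> F A X K L A0 X0 _ zX K_gt0.
have q_gt1 : (1 < #|F|)%N by apply/card_gt1P; exists 0, 1; rewrite eq_sym oner_neq0.
have lnq : ln 2 <= ln #|F|%:R :> R.
  by rewrite ler_ln ?posrE ?ltr0n ?ler_nat // ltnW.
pose lam := c * ln #|F|%:R.
have lam_ge : 1536 <= lam.
  by rewrite /lam /c mulrAC ler_pdivlMr //; apply: ler_wpM2l lnq; apply: ler0n.
have LE : L = lam ^+ N by rewrite /L powR_mulrn ?exprMn // (le_trans (ltW ln2_gt0)).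
pose l := (trunc_log 2 (#|A| ^ 2)).+1.
have l_le : 512 * l%:R <= lam.
  have nq : (0 < #|A| ^ 2 <= #|F| ^ 2)%N by rewrite expn_gt0 card_gt0 A0 leq_exp2r ?max_card.
  have := trunc_log_le_ln R nq q_gt1; rewrite -/l /lam /c => H.
  have -> : 1536 / ln 2 * ln #|F|%:R = 512 * (3 * ln #|F|%:R / ln 2) :> R by field; rewrite gt_eqF.
  by apply: ler_wpM2l H; apply: ler0n.
have n_gt0 : 0 < #|A|%:R :> R by rewrite ltr0n card_gt0.
have n3_gt0 : 0 < #|A|%:R ^+ 3 :> R by rewrite exprn_gt0.
have x_gt0 : 0 < #|X|%:R :> R by rewrite ltr0n card_gt0.
have e_le xi : (energy A xi)%:R <= #|A|%:R ^+ 3 :> R by rewrite -natrX ler_nat energy_le_cube.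
have l_ge0 : 0 <= l%:R :> R by [].
rewrite LE; split=> HE.
  have K_ge1 : 1 <= K.
    rewrite -(ler_pM2l (mulr_gt0 n3_gt0 x_gt0)) mulr1.
    move: HE; rewrite ler_pdivrMr // => /le_trans; apply; apply: ler_wpM2r; first exact: ltW.
    by rewrite mulrC mulr_natl -sumr_const; apply: ler_sum.
  (* The dilates left out supply at most half of the assumed lower bound, and no energy exceeds
     [|A|^3]; so [|X| <= 2 * K * |X1|], which is the fifth factor [K]. *)
  pose X1 := [set xi in X | #|A|%:R ^+ 3 / (2 * K) <= (energy A xi)%:R].
  have X1X : X1 \subset X by apply/subsetP=> xi /setIdP[].
  have X1_large : #|X|%:R <= 2 * K * #|X1|%:R.
    have H : \sum_(xi in X) (energy A xi)%:R <=
        #|X1|%:R * #|A|%:R ^+ 3 + #|X|%:R * (#|A|%:R ^+ 3 / (2 * K)).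
      rewrite (bigID (mem X1)) /=; apply: lerD.
        rewrite mulr_natl -sumr_const (eq_bigl (mem X1)); first exact: ler_sum.
        by move=> xi; rewrite andb_idl // => /(subsetP X1X).
      rewrite mulr_natl -sumr_const [leRHS](bigID (mem X1)) /= -[leLHS]add0r; apply: lerD.
        by apply: sumr_ge0 => xi _; rewrite divr_ge0 ?mulr_ge0 ?ltW.
      apply: ler_sum => xi /andP[xX xX1]; rewrite leNgt; apply: contra xX1 => /ltW lt.
      exact/setIdP.
    have {HE} := le_trans HE H.
    have -> : #|A|%:R ^+ 3 * #|X|%:R / K = #|A|%:R ^+ 3 / (2 * K) * (2 * #|X|%:R) :> R.
      by field; rewrite gt_eqF.
    have -> : #|X1|%:R * #|A|%:R ^+ 3 + #|X|%:R * (#|A|%:R ^+ 3 / (2 * K)) =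
        #|A|%:R ^+ 3 / (2 * K) * (2 * K * #|X1|%:R + #|X|%:R) :> R.
      by field; rewrite gt_eqF.
    by rewrite ler_pM2l ?divr_gt0 ?mulr_gt0 //; lra.
  have X10 : X1 != set0.
    rewrite -card_gt0 -(ltr0n R); have := lt_le_trans x_gt0 X1_large.
    by rewrite pmulr_rgt0 ?mulr_gt0.
  apply: (@structured_subsets_of_pointwise R F A X X1 K (2 * K) (2 * K)) => //.
  - by apply: contra zX; apply: (subsetP X1X).
  - by rewrite mulr_gt0.
  - by lra.
  - by move=> xi /setIdP[].
  - rewrite -/l; have -> : 256 * l%:R * (2 * K) = 512 * l%:R * K by ring.
    by apply: ler_wpM2r l_le; apply: ltW.
  - by rewrite mulr_ge0 ?ltW.
  rewrite -/l; have -> : 2 * K * (l%:R * (256 * l%:R * (2 * K)) ^+ 4) =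
     1 * ((2 * l%:R * K) * (512 * l%:R * K) ^+ 4) by ring.
  have lK : 0 <= l%:R * K by rewrite mulr_ge0 ?ltW.
  have wl : 512 * l%:R * K <= lam * K by apply: ler_wpM2r l_le; apply: ltW.
  apply: le_trans (_ : 1 * (512 * l%:R * K) ^+ 5 <= _).
    rewrite !mul1r [leRHS]exprS; apply: ler_wpM2r; last lra.
    by apply: exprn_ge0; lra.
  by apply: mulr_expr_le => //; [apply/andP; split; lra|apply/andP; split; lra|lra].
have K_ge1 : 1 <= K by apply: energy_bound_ge1 HE.
apply: (@structured_subsets_of_pointwise R F A X X K K 1) => //.
- lra.
- rewrite -/l; apply: ler_wpM2r; [exact: ltW|lra].
- by rewrite mul1r.
rewrite -/l mul1r; have lK : 0 <= l%:R * K by rewrite mulr_ge0 ?ltW.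
have wl : 512 * l%:R * K <= lam * K by apply: ler_wpM2r l_le; apply: ltW.
apply: mulr_expr_le => //; first by apply/andP; split; lra.
- by apply/andP; split; lra.
- lra.
- exact: ltnW N5.
Qed.
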